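(* For $i=1,\ldots,l$, let $P_i\subset\mathbb{E}_i$ be $0$-symmetric convex bodies in Euclidean spaces. (1) For any isometric embeddings $j_i:(\mathbb{E}_i,g_{P_i})\hookrightarrow\ell_\infty$, $i=1,\ldots,l$, $$P_1\otimes_{\pi^{inj}}\cdots\otimes_{\pi^{inj}}P_l=(j_1\otimes\cdots\otimes j_l)^{-1}\left(B_{\ell_\infty\hat\otimes_\pi\cdots\hat\otimes_\pi\ell_\infty}\cap\otimes_{i=1}^l j_i(\mathbb{E}_i)\right).$$ (2) For any quotient mappings $q_i:\ell_1\to(\mathbb{E}_i,g_{P_i})$, $i=1,\ldots,l$, $$P_1\otimes_{\epsilon^{proj}}\cdots\otimes_{\epsilon^{proj}}P_l=(q_1\otimes\cdots\otimes q_l)\left(B_{\ell_1\hat\otimes_\epsilon\cdots\hat\otimes_\epsilon\ell_1}\right).$$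
   Context: All spaces are real. A Euclidean space is a finite dimensional real inner product space; $\mathbb{E}_i,\mathbb{F}_i$ denote Euclidean spaces. $\otimes_{i=1}^l\mathbb{E}_i$ carries the scalar product determined by $\langle x^1\otimes\cdots\otimes x^l,y^1\otimes\cdots\otimes y^l\rangle_H=\prod_i\langle x^i,y^i\rangle_{\mathbb{E}_i}$. A convex body is a compact convex set with nonempty interior; it is $0$-symmetric if $P=-P$. The polar of $C$ is $C^\circ=\{y:\sup_{x\in C}\langle x,y\rangle\le1\}$ (with respect to $\langle\cdot,\cdot\rangle_H$ in tensor product spaces). $g_P(x)=\inf\{\lambda>0:\lambda^{-1}x\in P\}$, so $(\mathbb{E},g_P)$ is the normed space with closed unit ball $P$. For convex bodies $P_i\subset\mathbb{E}_i$ with $0$ in the interior, $P_1\otimes_\pi\cdots\otimes_\pi P_l:=\mathrm{conv}\{x^1\otimes\cdots\otimes x^l:x^i\in P_i\}$ and $P_1\otimes_\epsilon\cdots\otimes_\epsilon P_l:=(P_1^\circ\otimes_\pi\cdots\otimes_\pi P_l^\circ)^\circ$. A tensor product $\otimes_\alpha$ of order $l$ of $0$-symmetric convex bodies assigns to each $l$-tuple of $0$-symmetric convex bodies $P_i\subset\mathbb{E}_i$ a $0$-symmetric convex body $P_1\otimes_\alpha\cdots\otimes_\alpha P_l\subset\otimes_{i=1}^l\mathbb{E}_i$ such that (1) $P_1\otimes_\pi\cdots\otimes_\pi P_l\subseteq P_1\otimes_\alpha\cdots\otimes_\alpha P_l\subseteq P_1\otimes_\epsilon\cdots\otimes_\epsilon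 P_l$; (2) for all linear $T_i:\mathbb{E}_i\to\mathbb{F}_i$ and $0$-symmetric convex bodies $Q_i\subset\mathbb{F}_i$ with $T_i(P_i)\subseteq Q_i$, $T_1\otimes\cdots\otimes T_l(P_1\otimes_\alpha\cdots\otimes_\alpha P_l)\subseteq Q_1\otimes_\alpha\cdots\otimes_\alpha Q_l$. Both $\otimes_\pi$ and $\otimes_\epsilon$ are such. The dual $\otimes_{\alpha'}$ is $P_1\otimes_{\alpha'}\cdots\otimes_{\alpha'}P_l:=(P_1^\circ\otimes_\alpha\cdots\otimes_\alpha P_l^\circ)^\circ$. $\otimes_\alpha$ is injective if $(P_1\cap M_1)\otimes_\alpha\cdots\otimes_\alpha(P_l\cap M_l)=(P_1\otimes_\alpha\cdots\otimes_\alpha P_l)\cap\otimes_{i=1}^l M_i$ for all $0$-symmetric convex bodies $P_i\subset\mathbb{E}_i$ and subspaces $M_i\subseteq\mathbb{E}_i$ (with the induced scalar product). Write $\otimes_\alpha\subseteq\otimes_\beta$ if $P_1\otimes_\alpha\cdots\otimes_\alpha P_l\subseteq P_1\otimes_\beta\cdots\otimes_\beta P_l$ for all tuples. $P_1\otimes_{\alpha^{inj}}\cdots\otimes_{\alpha^{inj}}P_l:=\bigcap\{P_1\otimes_\beta\cdots\otimes_\beta P_l:\otimes_\beta\text{ injective},\ \otimes_\alpha\subseteq\otimes_\beta\}$ and $\otimes_{\alpha^{proj}}:=\otimes_{((\alpha')^{inj})'}$; these are applied here with $\alpha=\pi$ and $\alpha=\epsilon$ respectively. $B_X$ is the closed unit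 ball of the Banach space $X$; $X_1\hat\otimes_\pi\cdots\hat\otimes_\pi X_l$ and $X_1\hat\otimes_\epsilon\cdots\hat\otimes_\epsilon X_l$ are the completed projective and injective tensor products of Banach spaces, and $q_1\otimes\cdots\otimes q_l$ is extended by continuity to the completion. A quotient mapping $q:X\to Y$ is a bounded linear map sending the open unit ball of $X$ onto the open unit ball of $Y$.
   Formalization: In (2) the right-hand side is replaced by its closure: with closed unit balls and quotient mappings defined by open balls, the image of the closed ball need not be closed (e.g. l=1, P=[-1,1], q(x)=Σ(1-1/(n+1))x_n has image (-1,1)), while the left-hand side is compact. *)

(* Defs.v *)
From HB Require Import structures.
From mathcomp Require Import all_boot all_order all_algebra.
From mathcomp Require Import ring lra.
From mathcomp Require Import boolp classical_sets functions reals ereal.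
From mathcomp Require Import topology normedtype sequences convex.

Set Implicit Arguments.
Unset Strict Implicit.
Unset Printing Implicit Defensive.

Import Order.TTheory GRing.Theory Num.Theory.
Import numFieldNormedType.Exports.

Local Open Scope classical_set_scope.
Local Open Scope ring_scope.

(** * Euclidean spaces *)

HB.mixin Record NormedVector_hasDot (R : realType) E
    & NormedModule R E & Vector R E := {
  dot : E -> E -> R ;
  dotC : forall x y, dot x y = dot y x ;
  dotPl : forall y a u v, dot (a *: u + v) y = a * dot u y + dot v y ;
  dot_norm : forall x, dot x x = `|x| ^+ 2
}.

#[short(type="euclideanType")]
HB.structure Definition Euclidean (R : realType) :=
  {E of NormedModule R E & Vector R E & NormedVector_hasDot R E}.

HB.factory Record Vector_isEuclidean (R : realType) E & Vector R E := {
  dot : E -> E -> R ;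
  dotC : forall x y, dot x y = dot y x ;
  dotPl : forall y a u v, dot (a *: u + v) y = a * dot u y + dot v y ;
  dot_gt0 : forall x, x != 0 -> 0 < dot x x
}.

HB.builders Context R E & Vector_isEuclidean R E.

Fact dot0l y : dot 0 y = 0.
Proof.
have := dotPl y 1 0 0; rewrite scaler0 addr0 mul1r => /eqP.
by rewrite -subr_eq0 opprD addNKr oppr_eq0 => /eqP.
Qed.

Fact dotDl y u v : dot (u + v) y = dot u y + dot v y.
Proof. by have := dotPl y 1 u v; rewrite scale1r mul1r. Qed.

Fact dotZl y a u : dot (a *: u) y = a * dot u y.
Proof. by have := dotPl y a u 0; rewrite dot0l !addr0. Qed.

Fact dotDr y u v : dot y (u + v) = dot y u + dot y v.
Proof. by rewrite dotC dotDl !(dotC y). Qed.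

Fact dotZr y a u : dot y (a *: u) = a * dot y u.
Proof. by rewrite dotC dotZl !(dotC y). Qed.

Fact dot_ge0 x : 0 <= dot x x.
Proof. by have [->|/dot_gt0/ltW//] := eqVneq x 0; rewrite dot0l. Qed.

Fact cauchy_schwarz x y : dot x y ^+ 2 <= dot x x * dot y y.
Proof.
have [->|y0] := eqVneq y 0; first by rewrite dotC !dot0l expr0n mulr0.
have yy := dot_gt0 y0.
have := dot_ge0 (dot y y *: x + (- dot x y) *: y).
rewrite dotDl !dotDr !dotZl !dotZr (dotC y x).
set a := dot x x; set b := dot x y; set c := dot y y => h.
have : 0 <= c * (a * c - b ^+ 2).
  by move: h; congr (0 <= _); ring.
by rewrite pmulr_rge0// subr_ge0.
Qed.

Definition nrm x := Num.sqrt (dot x x).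

Fact nrm_ge0 x : 0 <= nrm x. Proof. exact: sqrtr_ge0. Qed.
Fact nrm_sqr x : nrm x ^+ 2 = dot x x. Proof. by rewrite /nrm sqr_sqrtr// dot_ge0. Qed.

Fact nrmD x y : nrm (x + y) <= nrm x + nrm y.
Proof.
rewrite -(@ler_pXn2r _ 2)// ?nnegrE ?addr_ge0 ?nrm_ge0//.
suff h : dot x y <= nrm x * nrm y.
  by rewrite sqrrD !nrm_sqr dotDl !dotDr (dotC y x); lra.
apply: (le_trans (ler_norm _)).
rewrite -(@ler_pXn2r _ 2)// ?nnegrE ?mulr_ge0 ?nrm_ge0//.
by rewrite real_normK ?num_real// exprMn !nrm_sqr cauchy_schwarz.
Qed.

Fact nrmZ a x : nrm (a *: x) = `|a| * nrm x.
Proof. by rewrite /nrm dotZl dotZr mulrA -expr2 sqrtrM ?sqr_ge0// sqrtr_sqr. Qed.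

Fact nrm0 x : nrm x = 0 -> x = 0.
Proof.
move=> nx; have [//|/dot_gt0] := eqVneq x 0.
by rewrite -sqrtr_gt0 -/(nrm x) nx ltxx.
Qed.

HB.instance Definition _ := Lmodule_isNormed.Build R E nrmD nrmZ nrm0.

Fact dot_nrm x : dot x x = `|x| ^+ 2.
Proof. by rewrite [`|x|]/(nrm x) nrm_sqr. Qed.

HB.instance Definition _ := NormedVector_hasDot.Build R E dotC dotPl dot_nrm.

HB.end.

Section EuclideanTheory.
Context {R : realType} {E : euclideanType R}.
Implicit Types x y : E.

Lemma dotDl x y z : dot (x + y) z = dot x z + dot y z :> R.
Proof. by have := dotPl z 1 x y; rewrite scale1r mul1r. Qed.

Lemma dot0l x : dot 0 x = 0 :> R.
Proof.
have /eqP := dotDl 0 0 x.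
by rewrite addr0 -subr_eq0 opprD addNKr oppr_eq0 => /eqP.
Qed.

Lemma dotZl a x y : dot (a *: x) y = a * dot x y :> R.
Proof. by have := dotPl y a x 0; rewrite dot0l !addr0. Qed.

Lemma dot_gt0 x : x != 0 -> 0 < dot x x :> R.
Proof. by move=> x0; rewrite dot_norm exprn_gt0// normr_gt0. Qed.

(* [dotr y] is the linear form [<., y>]. *)
Definition dotr y x : R := dot x y.
Lemma dotr_scalar y : scalar (dotr y).
Proof. by move=> a u v; rewrite /dotr dotPl. Qed.
HB.instance Definition _ y :=
  GRing.isLinear.Build R E R^o *%R (dotr y) (dotr_scalar y).

Lemma dotDr x y z : dot z (x + y) = dot z x + dot z y :> R.
Proof. by rewrite dotC dotDl !(dotC z). Qed.

Lemma dotZr a x y : dot y (a *: x) = a * dot y x :> R.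
Proof. by rewrite dotC dotZl !(dotC y). Qed.

End EuclideanTheory.

Section Subspace.
Context {R : realType} {E : euclideanType R} (M : {vspace E}).

Definition subvs_dot (u v : subvs_of M) : R := dot (vsval u) (vsval v).
Fact subvs_dotC u v : subvs_dot u v = subvs_dot v u.
Proof. exact: dotC. Qed.
Fact subvs_dotPl y a u v : subvs_dot (a *: u + v) y = a * subvs_dot u y + subvs_dot v y.
Proof. by rewrite /subvs_dot linearP dotPl. Qed.
Fact subvs_dot_gt0 u : u != 0 -> 0 < subvs_dot u u.
Proof. by move=> u0; apply: dot_gt0; apply: contra u0 => /eqP u0; apply/eqP/val_inj. Qed.

HB.instance Definition _ :=
  Vector_isEuclidean.Build R (subvs_of M) subvs_dotC subvs_dotPl subvs_dot_gt0.
End Subspace.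


(** * Algebraic tensor products *)

Section Multilinear.
Context {R : realType} {l : nat} (V : 'I_l -> lmodType R).

Record mform := MForm {
  mform_fun :> (forall i, V i) -> R ;
  mformP : forall (v : forall i, V i) i,
    scalar (fun x : V i => mform_fun (dfwith v x)) }.

Lemma mform_ext (f g : mform) : (forall x, f x = g x) -> f = g.
Proof.
case: f g => [f fP] [g gP] /= fg.
have {}fg : f = g by apply/funext.
by subst g; congr MForm; exact: Prop_irrelevance.
Qed.

Lemma prod_form_scalar (f : forall i, {scalar V i}) (v : forall i, V i) i :
  scalar (fun x : V i => \prod_(k < l) f k (dfwith v x k)).
Proof.
have E x : \prod_(k < l) f k (dfwith v x k) = f i x * \prod_(k < l | k != i) f k (v k).
  rewrite (bigD1 i)//= dfwith_in; congr (_ * _).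
  by apply: eq_bigr => k ki; rewrite dfwith_out// eq_sym.
by move=> a x y; rewrite !E (linearP (f i)) mulrDl -mulrA.
Qed.
Definition prod_form (f : forall i, {scalar V i}) :=
  @MForm (fun x => \prod_(k < l) f k (x k)) (prod_form_scalar f).

(* The tensor product over a field embeds in the algebraic dual of the space of
   multilinear forms, by evaluation. *)
Definition tensor_pred : {pred mform -> R^o} := fun u =>
  `[< exists n (c : 'I_n -> R) (x : 'I_n -> forall i, V i),
      u = \sum_(k < n) c k *: (fun f : mform => f (x k) : R^o) >].

Lemma tensor_predP : submod_closed tensor_pred.
Proof.
split.
  apply/asboolP; exists 0%N, (fun=> 0), (fun=> fun=> 0).
  by rewrite big_ord0.
move=> a u v /asboolP[n [c [x ->]]] /asboolP[m [d [y ->]]].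
apply/asboolP; exists (n + m)%N.
exists (fun k => match fintype.split k with inl i => a * c i | inr j => d j end).
exists (fun k => match fintype.split k with inl i => x i | inr j => y j end).
rewrite big_split_ord/= scaler_sumr; congr (_ + _); apply: eq_bigr => k _.
  by rewrite (unsplitK (inl k)) scalerA.
by rewrite (unsplitK (inr k)).
Qed.
HB.instance Definition _ :=
  GRing.isSubmodClosed.Build R (mform -> R^o) tensor_pred tensor_predP.

Record tensor := Tensor {
  tensor_fun :> mform -> R^o ;
  tensorP : tensor_fun \in tensor_pred }.
HB.instance Definition _ := [isSub for tensor_fun].
HB.instance Definition _ := [Choice of tensor by <:].
HB.instance Definition _ := [SubChoice_isSubLmodule of tensor by <:].

Lemma tens_subproof (x : forall i, V i) :
  (fun f : mform => f x : R^o) \in tensor_pred.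
Proof.
apply/asboolP; exists 1%N, (fun=> 1), (fun=> x).
by rewrite big_ord1 scale1r.
Qed.
(* [tens x] is the elementary tensor x_1 (x) ... (x) x_l. *)
Definition tens x : tensor := Tensor (tens_subproof x).

Lemma tensor_addE (u v : tensor) f : (u + v) f = u f + v f :> R.
Proof. by []. Qed.
Lemma tensor_scaleE a (u : tensor) f : (a *: u) f = a * u f :> R.
Proof. by []. Qed.
Lemma tensor_sumE n (F : 'I_n -> tensor) f : (\sum_(k < n) F k) f = \sum_(k < n) F k f :> R.
Proof. by elim/big_ind2 : _ => // u a v b <- <-. Qed.

Lemma tensor_ext (u v : tensor) : (forall f, u f = v f :> R) -> u = v.
Proof. by move=> uv; apply: val_inj; apply/funext. Qed.

Lemma tensor_eval (u : tensor) : exists n (c : 'I_n -> R) (x : 'I_n -> forall i, V i),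
  forall f, u f = \sum_(k < n) c k * f (x k) :> R.
Proof.
have /asboolP[n [c [x ->]]] := tensorP u; exists n, c, x => f.
by elim/big_rec2 : _ => // k a b _ <-.
Qed.

Lemma tensor_span (u : tensor) : exists n (c : 'I_n -> R) (x : 'I_n -> forall i, V i),
  u = \sum_(k < n) c k *: tens (x k).
Proof.
have [n [c [x ux]]] := tensor_eval u; exists n, c, x.
by apply: tensor_ext => f; rewrite ux tensor_sumE.
Qed.

End Multilinear.

Section TensorMap.
Context {R : realType} {l : nat} (V W : 'I_l -> lmodType R).
Variable T : forall i, {linear V i -> W i}.

Lemma mform_comp_subproof (f : mform W) (v : forall i, V i) i :
  scalar (fun x : V i => f (fun k => T k (dfwith v x k))).
Proof.
have E x : (fun k => T k (dfwith v x k)) = dfwith (fun k => T k (v k)) (T i x).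
  apply: functional_extensionality_dep => k.
  have [<-|ik] := eqVneq i k; first by rewrite !dfwith_in.
  by rewrite !dfwith_out.
by move=> a x y; rewrite !E linearP mformP.
Qed.
Definition mform_comp (f : mform W) :=
  @MForm R l V (fun x => f (fun k => T k (x k))) (mform_comp_subproof f).

Lemma tensor_map_subproof (u : tensor V) :
  (fun f => u (mform_comp f)) \in tensor_pred (V := W).
Proof.
have [n [c [x ux]]] := tensor_eval u.
apply/asboolP; exists n, c, (fun k i => T i (x k i)).
apply/funext => f; rewrite ux.
by elim/big_rec2 : _ => // k a b _ ->.
Qed.
(* T_1 (x) ... (x) T_l *)
Definition tensor_map u : tensor W := Tensor (tensor_map_subproof u).

Lemma tensor_map_linear : linear tensor_map.
Proof. by move=> a u v; apply: tensor_ext. Qed.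
HB.instance Definition _ :=
  GRing.isLinear.Build R (tensor V) (tensor W) *:%R tensor_map tensor_map_linear.

Lemma tensor_map_tens x : tensor_map (tens x) = tens (fun i => T i (x i)).
Proof. exact: tensor_ext. Qed.

End TensorMap.

(** * The tensor product of Euclidean spaces *)

Section OrthonormalBasis.
Context {R : realType} (E : euclideanType R).

Local Definition onf n (e : 'I_n -> E) := forall i j, dot (e i) (e j) = (i == j)%:R :> R.

Local Lemma dot_suml n (c : 'I_n -> R) (e : 'I_n -> E) y :
  dot (\sum_i c i *: e i) y = \sum_i c i * dot (e i) y.
Proof. by rewrite -/(dotr y _) linear_sum; apply: eq_bigr => i _; rewrite linearZ. Qed.

Local Lemma onf_free n (e : 'I_n -> E) : onf e -> (n <= \dim {:E})%N.
Proof.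
move=> eP; have : free (mktuple e).
  apply/freeP => c c0 i; have /(congr1 (fun x => dot x (e i) : R)) := c0.
  rewrite (eq_bigr (fun i => c i *: e i)); last first.
    by move=> j _; rewrite -tnth_nth tnth_mktuple.
  rewrite dot_suml dot0l (bigD1 i)//= eP eqxx mulr1 big1 ?addr0// => j ji.
  by rewrite eP (negbTE ji) mulr0.
by rewrite /free size_tuple => /eqP <-; rewrite dimvS// subvf.
Qed.

Lemma orthonormal_basis : exists n (e : 'I_n -> E),
  (forall i j, dot (e i) (e j) = (i == j)%:R :> R) /\
  (forall x, x = \sum_i (dot x (e i) : R) *: e i).
Proof.
pose P n := `[< exists e : 'I_n -> E, onf e >].
have P0 : exists n, P n.
  by exists 0%N; apply/asboolP; exists (fun=> 0) => -[].
have Pb n : P n -> (n <= \dim {:E})%N by move=> /asboolP[e]; exact: onf_free.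
case: (ex_maxnP P0 Pb) => n /asboolP[e eP] nmax.
exists n, e; split => // x; apply/eqP; rewrite -subr_eq0; apply/negP => /negP.
set w := x - _ => w0.
have we i : dot w (e i) = 0 :> R.
  rewrite /w -scaleN1r dotDl dotZl dot_suml (bigD1 i)//= eP eqxx mulr1.
  rewrite big1 ?addr0 ?mulN1r ?subrr// => j ji.
  by rewrite eP (negbTE ji) mulr0.
pose f : E := `|w|^-1 *: w.
have fe i : dot f (e i) = 0 :> R by rewrite dotZl we mulr0.
have ff : dot f f = 1 :> R.
  by rewrite dot_norm normrZ normfV normr_id mulVf ?expr1n// normr_eq0.
suff /nmax : P n.+1 by rewrite ltnn.
apply/asboolP; exists (fun k => if unlift ord_max k is Some i then e i else f) => i j.
case: unliftP => [i' ->|->]; case: unliftP => [j' ->|->].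
- by rewrite eP (inj_eq lift_inj).
- by rewrite dotC fe eq_sym (negbTE (neq_lift _ _)).
- by rewrite fe (negbTE (neq_lift _ _)).
- by rewrite ff eqxx.
Qed.
End OrthonormalBasis.

Section EuclideanTensor.
Context {R : realType} {l : nat} (E : 'I_l -> euclideanType R).

Definition etensor := tensor (fun i => E i : lmodType R).
HB.instance Definition _ := GRing.Lmodule.on etensor.

Definition dot_form (y : forall i, E i) : mform (fun i => E i : lmodType R) :=
  prod_form (fun i => dotr (y i) : {scalar E i}).

Lemma etensor_dot_subproof (u : etensor) (v : forall i, E i) i :
  scalar (fun y : E i => u (dot_form (dfwith v y)) : R).
Proof.
have [n [c [x ux]]] := tensor_eval u.
have sw w : u (dot_form (dfwith v w)) = \sum_(k < n) c k * dot_form (x k) (dfwith v w).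
  rewrite ux; apply: eq_bigr => k _; congr (_ * _).
  by apply: eq_bigr => j _; rewrite /= /dotr dotC.
move=> a y z; rewrite !sw mulr_sumr -big_split; apply: eq_bigr => k _ /=.
by have /= -> := mformP (dot_form (x k)) v a y z; rewrite mulrDr mulrCA.
Qed.
Definition etensor_form (u : etensor) :=
  @MForm R l (fun i => E i : lmodType R) (fun y => u (dot_form y))
    (etensor_dot_subproof u).

(* <u, v>_H is [v] applied to the multilinear form y |-> <u, y_1 (x) ... (x) y_l>_H,
   whose value at y is in turn [u] applied to x |-> \prod_i <x_i, y_i>. *)
Definition etensor_dot (u v : etensor) : R := v (etensor_form u).

Definition onb_ex := fun i => cid (orthonormal_basis (E i)).
Definition onb_dim i := projT1 (onb_ex i).
Definition onb_ex2 i := cid (projT2 (onb_ex i)).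
Definition onb i : 'I_(onb_dim i) -> E i := projT1 (onb_ex2 i).
Fact onb_onf i : forall j k, dot (onb j) (onb k) = (j == k :> 'I_(onb_dim i))%:R :> R.
Proof. exact: (projT2 (onb_ex2 i)).1. Qed.
Fact onb_expand i : forall x, x = \sum_(j < onb_dim i) (dot x (onb j) : R) *: onb j.
Proof. exact: (projT2 (onb_ex2 i)).2. Qed.

Definition onb_index := {dffun forall i : 'I_l, 'I_(onb_dim i)}.
Definition onb_tuple (a : onb_index) : forall i, E i := fun i => onb (a i).

Fact dot_form_onb (a b : onb_index) : dot_form (onb_tuple a) (onb_tuple b) = (a == b)%:R.
Proof.
rewrite /=; have [->|ab] := eqVneq a b.
  by apply: big1 => i _; rewrite /dotr /onb_tuple onb_onf eqxx.
have [i abi] : exists i, b i != a i.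
  apply/existsP; rewrite -negb_forall; apply: contra ab => /forallP ab.
  by apply/eqP/ffunP => i; apply/esym/eqP/ab.
by rewrite (bigD1 i)//= /dotr /onb_tuple onb_onf (negbTE abi) mul0r.
Qed.

Fact dfwith_id (x : forall i, E i) i : dfwith x (x i) = x.
Proof. by apply: functional_extensionality_dep => j; case: dfwithP. Qed.
Fact dfwith_dfwith (x : forall i, E i) i (y z : E i) :
  dfwith (dfwith x y) z = dfwith x z.
Proof.
apply: functional_extensionality_dep => j.
have [<-|ij] := eqVneq i j; first by rewrite !dfwith_in.
by rewrite !dfwith_out.
Qed.

Fact mform_onb_sum (f : mform (fun i => E i : lmodType R)) x i m
    (c : 'I_m -> R) (y : 'I_m -> E i) :
  f (dfwith x (\sum_k c k *: y k)) = \sum_k c k * f (dfwith x (y k)).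
Proof.
have f0 : f (dfwith x (0 : E i)) = 0.
  have := mformP f x 1 (0 : E i) 0; rewrite scaler0 addr0 mul1r => /eqP.
  by rewrite -subr_eq0 opprD addNKr oppr_eq0 => /eqP.
elim/big_rec2 : _ => //= k a b _ <-.
by rewrite (mformP f).
Qed.

Fact mform_onb_eq (f g : mform (fun i => E i : lmodType R)) :
  (forall a, f (onb_tuple a) = g (onb_tuple a)) -> forall x, f x = g x.
Proof.
move=> fg x.
suff : forall s : seq 'I_l, forall x : forall i, E i,
    (forall i, i \notin s -> exists j, x i = onb (j : 'I_(onb_dim i))) -> f x = g x.
  by move=> H; apply: (H (enum 'I_l)) => i; rewrite mem_enum.
elim=> [|i s IH] {}x xP.
  have {}xP i : {j : 'I_(onb_dim i) | x i = onb j} by apply/cid/xP.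
  rewrite (_ : x = onb_tuple [ffun i => projT1 (xP i)])//.
  by apply: functional_extensionality_dep => i; rewrite /onb_tuple ffunE; case: (xP i).
rewrite -(dfwith_id x i) [x i]onb_expand !mform_onb_sum; apply: eq_bigr => j _.
congr (_ * _); apply: IH => k ks.
have [ik|ik] := eqVneq i k; first by subst k; rewrite dfwith_in; exists j.
by rewrite dfwith_out//; apply: xP; rewrite in_cons negb_or eq_sym ik.
Qed.

Fact mform_onb_expand (f : mform (fun i => E i : lmodType R)) x :
  f x = \sum_(a : onb_index) f (onb_tuple a) * dot_form (onb_tuple a) x.
Proof.
have gP (v : forall i, E i) i :
    scalar (fun y : E i =>
      \sum_(a : onb_index) f (onb_tuple a) * dot_form (onb_tuple a) (dfwith v y)).
  move=> c y z; rewrite mulr_sumr -big_split; apply: eq_bigr => a _.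
  by rewrite (mformP (dot_form (onb_tuple a))) mulrDr mulrCA.
pose g y := \sum_(a : onb_index) f (onb_tuple a) * dot_form (onb_tuple a) y.
apply: (@mform_onb_eq f (@MForm R l (fun i => E i : lmodType R) g gP)) => b.
change (f (onb_tuple b) = g (onb_tuple b)); rewrite /g.
rewrite (bigD1 b)// dot_form_onb eqxx mulr1 big1 => [|a ab]; first by rewrite [RHS]addr0.
by rewrite dot_form_onb (negbTE ab) mulr0.
Qed.

Fact etensor_expand (u : etensor) f :
  u f = \sum_(a : onb_index) u (dot_form (onb_tuple a)) * f (onb_tuple a) :> R.
Proof.
have [m [c [x ux]]] := tensor_eval u.
rewrite ux; under [RHS]eq_bigr do rewrite ux mulr_suml.
rewrite exchange_big; apply: eq_bigr => k _ /=.
rewrite [f (x k)]mform_onb_expand mulr_sumr; apply: eq_bigr => a _.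
by rewrite mulrA mulrAC.
Qed.

Fact etensor_dotE u v : etensor_dot u v =
  \sum_(a : onb_index) (u (dot_form (onb_tuple a)) * v (dot_form (onb_tuple a)) : R).
Proof.
rewrite /etensor_dot etensor_expand; apply: eq_bigr => a _.
by rewrite mulrC.
Qed.

Fact etensor_dotC u v : etensor_dot u v = etensor_dot v u.
Proof. by rewrite !etensor_dotE; apply: eq_bigr => a _; rewrite mulrC. Qed.

Fact etensor_dotPl w a u v :
  etensor_dot (a *: u + v) w = a * etensor_dot u w + etensor_dot v w.
Proof.
rewrite !etensor_dotE mulr_sumr -big_split; apply: eq_bigr => k _ /=.
by rewrite mulrDl mulrA.
Qed.

Fact etensor_dot_gt0 u : u != 0 -> 0 < etensor_dot u u.
Proof.
move=> u0; rewrite lt_neqAle eq_sym; apply/andP; split; last first.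
  by rewrite etensor_dotE sumr_ge0// => a _; rewrite -expr2 sqr_ge0.
apply: contra u0; rewrite etensor_dotE psumr_eq0; last first.
  by move=> a _; rewrite -expr2 sqr_ge0.
move=> /allP u0; apply/eqP; apply: tensor_ext => f.
rewrite etensor_expand big1// => a _.
have /eqP := u0 a (mem_index_enum a).
by rewrite /= => /eqP; rewrite mulf_eq0 orbb => /eqP ->; rewrite mul0r.
Qed.

Fact etensor_vect_iso : Vector.axiom #|onb_index| etensor.
Proof.
exists (fun u : etensor => \row_k (u (dot_form (onb_tuple (enum_val k))) : R)).
  by move=> a u v; apply/rowP => k; rewrite !mxE.
exists (fun r : 'rV_#|onb_index| =>
  \sum_k r 0 k *: (tens (onb_tuple (enum_val k)) : etensor)).
  move=> u; apply: tensor_ext => f; rewrite tensor_sumE etensor_expand.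
  rewrite [RHS](reindex (@enum_val onb_index predT))/=; last first.
    by apply: onW_bij; exact: enum_val_bij.
  by apply: eq_bigr => k _; rewrite mxE.
move=> r; apply/rowP => k; rewrite !mxE tensor_sumE (bigD1 k)// big1 => [|i ik].
  by rewrite [LHS]addr0 tensor_scaleE [X in _ * X]dot_form_onb eqxx mulr1.
rewrite tensor_scaleE [X in _ * X]dot_form_onb (inj_eq enum_val_inj).
by rewrite eq_sym (negbTE ik) mulr0.
Qed.

HB.instance Definition _ :=
  Lmodule_hasFinDim.Build R etensor etensor_vect_iso.
HB.instance Definition _ :=
  Vector_isEuclidean.Build R etensor etensor_dotC etensor_dotPl etensor_dot_gt0.

Lemma dot_tens (x y : forall i, E i) :
  dot (tens x : etensor) (tens y) = \prod_i (dot (x i) (y i) : R) :> R.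
Proof. by []. Qed.

End EuclideanTensor.

(** * The sequence spaces l_1 and l_oo *)

Section EllInfty.
Context {R : realType}.

Definition ell_infty_pred : {pred nat -> R^o} := fun x =>
  `[< exists M : R, forall n, `|x n| <= M >].

Lemma ell_infty_predP : submod_closed ell_infty_pred.
Proof.
split; first by apply/asboolP; exists 0 => n; rewrite normr0.
move=> a x y /asboolP[M xM] /asboolP[N yN]; apply/asboolP.
exists (`|a| * M + N) => n; apply: (le_trans (ler_normD _ _)).
by rewrite lerD// normrM ler_wpM2l.
Qed.
HB.instance Definition _ :=
  GRing.isSubmodClosed.Build R (nat -> R^o) ell_infty_pred ell_infty_predP.

Record ell_infty := EllInfty {
  ell_infty_seq :> nat -> R^o ;
  ell_inftyP : ell_infty_seq \in ell_infty_pred }.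
HB.instance Definition _ := [isSub for ell_infty_seq].
HB.instance Definition _ := [Choice of ell_infty by <:].
HB.instance Definition _ := [SubChoice_isSubLmodule of ell_infty by <:].

Definition ell_infty_norm (x : ell_infty) : R := sup (range (fun n => `|x n : R|)).

Fact ell_infty_has_sup (x : ell_infty) : has_sup (range (fun n => `|x n : R|)).
Proof.
split; first by exists `|x 0%N|, 0%N.
by have /asboolP[M xM] := ell_inftyP x; exists M => _ [n _ <-].
Qed.

Lemma ell_infty_norm_ub (x : ell_infty) n : `|x n : R| <= ell_infty_norm x.
Proof. by apply: (ub_le_sup (ell_infty_has_sup x).2); exists n. Qed.

Lemma ell_infty_norm_le (x : ell_infty) (M : R) :
  (forall n, `|x n : R| <= M) -> ell_infty_norm x <= M.
Proof.
move=> xM; apply: (ge_sup (ell_infty_has_sup x).1).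
by move=> _ [n _ <-].
Qed.

Fact ell_infty_normD x y : ell_infty_norm (x + y) <= ell_infty_norm x + ell_infty_norm y.
Proof.
apply: ell_infty_norm_le => n; apply: (le_trans (ler_normD _ _)).
by rewrite lerD// ell_infty_norm_ub.
Qed.

Fact ell_infty_normZ a x : ell_infty_norm (a *: x) = `|a| * ell_infty_norm x.
Proof.
have le b y : ell_infty_norm (b *: y) <= `|b| * ell_infty_norm y.
  apply: ell_infty_norm_le => n; rewrite [_ n]/(b * y n) normrM ler_wpM2l//.
  exact: ell_infty_norm_ub.
apply/eqP; rewrite eq_le le/=; have [->|a0] := eqVneq a 0.
  by rewrite normr0 mul0r (le_trans (normr_ge0 _) (ell_infty_norm_ub _ 0)).
by rewrite -ler_pdivlMl ?normr_gt0// -normfV (le_trans _ (le _ _))// scalerA mulVf//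
  scale1r.
Qed.

Fact ell_infty_norm0 x : ell_infty_norm x = 0 -> x = 0.
Proof.
move=> x0; apply: val_inj; apply/funext => n; apply/eqP.
by rewrite -normr_le0 -x0 ell_infty_norm_ub.
Qed.

HB.instance Definition _ :=
  Lmodule_isNormed.Build R ell_infty ell_infty_normD ell_infty_normZ ell_infty_norm0.

End EllInfty.
Arguments ell_infty : clear implicits.

Section EllOne.
Context {R : realType}.

Definition ell_one_pred : {pred nat -> R^o} := fun x =>
  `[< cvgn (series (fun n => `|x n : R|)) >].

Fact ell_one_pred_dom (a : R) (x y : nat -> R^o) :
  cvgn (series (fun n => `|x n : R|)) -> cvgn (series (fun n => `|y n : R|)) ->
  cvgn (series (fun n => `|a| * `|x n : R| + `|y n : R|)).
Proof.
move=> cx cy; rewrite (_ : series _ =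
  `|a| *: series (fun n => `|x n|) + series (fun n => `|y n|)).
  by apply: is_cvgD => //; exact: is_cvgZl_tmp.
by apply/funext => n; rewrite /series/= big_split/= -mulr_sumr.
Qed.

Lemma ell_one_predP : submod_closed ell_one_pred.
Proof.
split.
  apply/asboolP; rewrite (_ : series _ = cst 0); first exact: is_cvg_cst.
  by apply/funext => n; rewrite /series/= big1// => i _; rewrite normr0.
move=> a x y /asboolP cx /asboolP cy; apply/asboolP.
have le n : `|(a *: x + y) n : R| <= `|a| * `|x n : R| + `|y n : R|.
  by rewrite (le_trans (ler_normD _ _))// lerD2r normrM.
refine (series_le_cvg _ _ le (@ell_one_pred_dom a _ _ cx cy)) => n.
  exact: normr_ge0.
by rewrite addr_ge0// mulr_ge0.
Qed.
HB.instance Definition _ :=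
  GRing.isSubmodClosed.Build R (nat -> R^o) ell_one_pred ell_one_predP.

Record ell_one := EllOne {
  ell_one_seq :> nat -> R^o ;
  ell_oneP : ell_one_seq \in ell_one_pred }.
HB.instance Definition _ := [isSub for ell_one_seq].
HB.instance Definition _ := [Choice of ell_one by <:].
HB.instance Definition _ := [SubChoice_isSubLmodule of ell_one by <:].

Definition ell_one_norm (x : ell_one) : R := limn (series (fun n => `|x n : R|)).

Fact ell_one_cvg (x : ell_one) : cvgn (series (fun n => `|x n : R|)).
Proof. exact/asboolP/ell_oneP. Qed.

Lemma ell_one_norm_ub (x : ell_one) n : \sum_(0 <= k < n) `|x k : R| <= ell_one_norm x.
Proof.
have nd : nondecreasing_seq (series (fun n => `|x n : R|)).
  by apply: nondecreasing_series => k _ _; exact: normr_ge0.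
exact: (nondecreasing_cvgn_le nd (@ell_one_cvg x) n).
Qed.

Lemma ell_one_norm_le (x : ell_one) (M : R) :
  (forall n, \sum_(0 <= k < n) `|x k : R| <= M) -> ell_one_norm x <= M.
Proof. by move=> xM; apply: (limr_le (@ell_one_cvg x)); apply: nearW. Qed.

Fact ell_one_normD x y : ell_one_norm (x + y) <= ell_one_norm x + ell_one_norm y.
Proof.
apply: ell_one_norm_le => n.
apply: (le_trans _ (lerD (ell_one_norm_ub x n) (ell_one_norm_ub y n))).
by rewrite -big_split/=; apply: ler_sum => k _; exact: ler_normD.
Qed.

Fact ell_one_normZ a x : ell_one_norm (a *: x) = `|a| * ell_one_norm x.
Proof.
have le b y : ell_one_norm (b *: y) <= `|b| * ell_one_norm y.
  apply: ell_one_norm_le => n.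
  apply: (le_trans _ (ler_wpM2l _ (ell_one_norm_ub y n))) => //.
  by rewrite mulr_sumr; apply: ler_sum => k _; rewrite -normrM.
apply/eqP; rewrite eq_le le/=; have [->|a0] := eqVneq a 0.
  by rewrite normr0 mul0r (le_trans _ (ell_one_norm_ub _ 0))// big_nil.
by rewrite -ler_pdivlMl ?normr_gt0// -normfV (le_trans _ (le _ _))// scalerA mulVf//
  scale1r.
Qed.

Fact ell_one_norm0 x : ell_one_norm x = 0 -> x = 0.
Proof.
move=> x0; apply: val_inj; apply/funext => n; apply/eqP.
rewrite -normr_le0 -x0 (le_trans _ (ell_one_norm_ub x n.+1))//.
by rewrite big_nat_recr//= lerDr sumr_ge0.
Qed.

HB.instance Definition _ :=
  Lmodule_isNormed.Build R ell_one ell_one_normD ell_one_normZ ell_one_norm0.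

End EllOne.
Arguments ell_one : clear implicits.

(** * Tensor products of normed spaces *)

Definition unit_ball {R : realType} (X : normedModType R) : set X :=
  [set x | `|x| <= 1].
Arguments unit_ball {R} X.

Section BanachTensor.
Context {R : realType} {l : nat} (X : 'I_l -> normedModType R).
Let XX := tensor (fun i => X i : lmodType R).

Definition projective_norm (u : XX) : R :=
  inf [set s | exists n (x : 'I_n -> forall i, X i),
    u = \sum_(k < n) tens (x k) /\ s = \sum_(k < n) \prod_(i < l) `|x k i|].

(* [u (prod_form f)] is (f_1 (x) ... (x) f_l)(u). *)
Definition injective_norm (u : XX) : R :=
  sup [set s | exists2 f : forall i, {scalar X i},
    (forall i x, `|f i x| <= `|x|) & s = `|u (prod_form f) : R|].
End BanachTensor.

(* [X], with the map [iota], is a completion of the space [V] normed by [N]; it is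
   unique up to a linear isometry commuting with the maps from [V]. *)
Definition is_completion {R : realType} (V : lmodType R) (N : V -> R)
    (X : completeNormedModType R) (iota : {linear V -> X}) : Prop :=
  (forall v, `|iota v| = N v) /\ dense (range iota).

(** * Convex bodies and their tensor products *)

Section ConvexBodies.
Context {R : realType}.

Definition sym_convex_body (E : euclideanType R) (P : set E) : Prop :=
  [/\ compact P, convex_set (P : set (convex_lmodType E)),
      interior P !=set0 & [set - x | x in P] = P].

Definition polar (E : euclideanType R) (C : set E) : set E :=
  [set y | (ereal_sup [set (dot x y)%:E | x in C] <= 1)%E].

Definition convex_hull (E : euclideanType R) (A : set E) : set E :=
  smallest (fun C : set E => convex_set (C : set (convex_lmodType E))) A.

Definition gauge (E : euclideanType R) (P : set E) (x : E) : R :=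
  inf [set r | 0 < r /\ P (r^-1 *: x)].

Definition isometric_embedding (E : euclideanType R) (P : set E) (X : normedModType R)
    (j : {linear E -> X}) : Prop :=
  forall x, `|j x| = gauge P x.

Definition quotient_mapping (X : normedModType R) (E : euclideanType R) (P : set E)
    (q : {linear X -> E}) : Prop :=
  (exists C : R, forall x, gauge P (q x) <= C * `|x|) /\
  q @` [set x | `|x| < 1] = [set y | gauge P y < 1].

Variable l : nat.

(* Operations on [l]-tuples of sets; only the values on tuples of 0-symmetric
   convex bodies matter, the others are junk. *)
Definition body_op := forall E : 'I_l -> euclideanType R,
  (forall i, set (E i)) -> set (etensor E).

Definition pi_prod : body_op := fun E P =>
  convex_hull [set (tens x : etensor E) |
    x in [set x : forall i, E i | forall i, P i (x i)]].

Definition dual_op (a : body_op) : body_op := fun E P =>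
  polar (a E (fun i => polar (P i))).

Definition eps_prod : body_op := dual_op pi_prod.

Record tensor_product (a : body_op) : Prop := {
  tensor_product_body : forall (E : 'I_l -> euclideanType R) (P : forall i, set (E i)),
    (forall i, sym_convex_body (P i)) -> sym_convex_body (a E P) ;
  tensor_product_bounds : forall (E : 'I_l -> euclideanType R) (P : forall i, set (E i)),
    (forall i, sym_convex_body (P i)) ->
    pi_prod P `<=` a E P /\ a E P `<=` eps_prod P ;
  tensor_product_uniform : forall (E F : 'I_l -> euclideanType R)
    (P : forall i, set (E i)) (Q : forall i, set (F i))
    (T : forall i, {linear E i -> F i}),
    (forall i, sym_convex_body (P i)) -> (forall i, sym_convex_body (Q i)) ->
    (forall i, T i @` P i `<=` Q i) ->
    tensor_map T @` a E P `<=` a F Q }.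

(* P_i `&` M_i is seen as a subset of the Euclidean space M_i, and (x)_i M_i as the
   range of the tensor product of the inclusions. *)
Definition injective_op (a : body_op) : Prop :=
  forall (E : 'I_l -> euclideanType R) (P : forall i, set (E i))
    (M : forall i, {vspace E i}),
  (forall i, sym_convex_body (P i)) ->
  let incl := tensor_map (fun i => vsval : {linear subvs_of (M i) -> E i}) in
  incl @` a (fun i => subvs_of (M i)) (fun i => vsval @^-1` P i) =
  a E P `&` range incl.

Definition le_op (a b : body_op) : Prop :=
  forall (E : 'I_l -> euclideanType R) (P : forall i, set (E i)),
  (forall i, sym_convex_body (P i)) -> a E P `<=` b E P.

Definition inj_op (a : body_op) : body_op := fun E P =>
  [set z | forall b : body_op,
    tensor_product b -> injective_op b -> le_op a b -> b E P z].

Definition proj_op (a : body_op) : body_op := dual_op (inj_op (dual_op a)).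

End ConvexBodies.

(* Main.v *)
From HB Require Import structures.
Require Import Defs.
From mathcomp Require Import all_boot all_order all_algebra.
From mathcomp Require Import ring lra interval_inference.
From mathcomp Require Import boolp classical_sets functions reals ereal.
From mathcomp Require Import topology normedtype sequences convex derive.

(** Injective hull.  The space l_oo is injective: by Hahn-Banach, applied coordinate
    by coordinate, a map into l_oo extends from a subspace without increase of norm
    ([ell_infty_extend]).  Hence the norm that E_1 (x) ... (x) E_l receives from the
    projective norm of l_oo (x) ... (x) l_oo does not depend on the isometric
    embeddings, decreases under contractions, and respects subspaces
    ([projective_norm_mono]).  Its unit balls [ell_infty_prod] therefore form an
    injective tensor product; it contains the projective one, so the injective hull
    is contained in it.

    Conversely, let b be an injective tensor product above the projective one.  A
    representation of (j_1 (x) ... (x) j_l) z as a sum of elementary tensors uses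
    finitely many vectors of l_oo.  With j_i(E_i) they span a finite-dimensional space
    F_i, and the sum bounds the gauge of the b-product of the unit balls of the F_i,
    because b contains the projective product.  By injectivity of b the bound holds
    for the b-product of the P_i at z ([gauge_le_projective_norm]).  This gives
    [inj_op_pi_prod].

    Projective hull.  By the bipolar theorem the projective hull of the injective
    product at P is the polar of the injective hull of the projective product at the
    polars of the P_i ([proj_op_eps_prod]).  The adjoint j_i of the quotient map q_i
    embeds E_i, with the gauge of the polar of P_i, isometrically into l_oo
    ([quotient_adjoint]).  So, by the first part, the hull is the polar of the unit
    ball A of the norm z |-> |(j_1 (x) ... (x) j_l) z|_pi.  It remains to show that A
    and the image of the ball of the completed injective product are polar to each
    other, up to closure.

    That they pair to at most 1 is [dot_tensor_map_le], extended to the completion by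
    density.  For the other inclusion, Hahn-Banach is applied to the quotient seminorm
    of the injective norm; the supporting functional is the product with a vector z,
    and z must be shown to lie in A.  This is [projective_norm_dual]: if
    <(q_1 (x) ... (x) q_l) u, z> is at most |u|_eps for all u, then
    w = (j_1 (x) ... (x) j_l) z has projective norm at most 1.  Take a functional Phi of
    norm 1 that norms w.  The finitely many bounded sequences that occur in w are
    nearly constant on the blocks of a finite partition of the indices
    ([ell_infty_finite_net]), so w hardly changes when every sequence is replaced by
    its values at chosen points of the blocks ([tens_close]).  On the changed tensors,
    Phi is the pairing with a finitely supported u of injective norm at most 1
    ([discretization]). *)

Import Order.TTheory GRing.Theory Num.Theory.
Import numFieldNormedType.Exports.

Local Open Scope classical_set_scope.
Local Open Scope ring_scope.

Set Implicit Arguments.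
Unset Strict Implicit.
Unset Printing Implicit Defensive.


(** * The Hahn-Banach theorem *)

Section LinearConstructors.
Context {R : realType}.

Definition mk_linear {V W : lmodType R} (f : V -> W) (fP : linear f) : {linear V -> W} :=
  HB.pack f (GRing.isLinear.Build R V W *:%R f fP).

Definition mk_scalar {V : lmodType R} (f : V -> R) (fP : scalar f) : {scalar V} :=
  HB.pack f (GRing.isLinear.Build R V R^o *%R f fP).

End LinearConstructors.

Definition seminorm {R : realType} {V : lmodType R} (p : V -> R) : Prop :=
  (forall x y, p (x + y) <= p x + p y) /\ (forall a x, p (a *: x) = `|a| * p x).

Section Seminorm.
Context {R : realType} {V : lmodType R} {p : V -> R}.
Hypothesis pS : seminorm p.

Lemma seminorm0 : p 0 = 0.
Proof. by rewrite -(scale0r 0) pS.2 normr0 mul0r. Qed.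

Lemma seminormN x : p (- x) = p x.
Proof. by rewrite -scaleN1r pS.2 normrN1 mul1r. Qed.

Lemma seminorm_ge0 x : 0 <= p x.
Proof. by have := pS.1 x (- x); rewrite subrr seminorm0 seminormN; lra. Qed.

Lemma seminorm_sum n (F : 'I_n -> V) : p (\sum_k F k) <= \sum_k p (F k).
Proof.
elim/big_rec2 : _ => [|k y x _ le]; first by rewrite seminorm0.
by rewrite (le_trans (pS.1 _ _))// lerD2l.
Qed.

Lemma seminorm_comp (W : lmodType R) (f : {linear W -> V}) : seminorm (p \o f).
Proof.
by split=> [x y|a x] /=; [rewrite linearD; exact: pS.1 | rewrite linearZ pS.2].
Qed.

End Seminorm.

Lemma normr_seminorm {R : realType} {V : normedModType R} :
  seminorm (fun x : V => `|x|).
Proof. by split=> [x y|a x]; [exact: ler_normD | rewrite normrZ]. Qed.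

Section HahnBanach.
Context {R : realType} {V : lmodType R} (p : V -> R).
Hypothesis pD : forall x y, p (x + y) <= p x + p y.
Hypothesis pZ : forall t x, 0 <= t -> p (t *: x) = t * p x.

(** Linear functionals on subspaces are handled through their graphs, so that chains
    of extensions are unions of sets; that such a graph is single-valued follows from
    the domination by [p] ([dominated_graph_inj]). *)
Definition dominated_graph (G : set (V * R)) : Prop :=
  [/\ G 0, (forall a g h, G g -> G h -> G (a *: g.1 + h.1, a * g.2 + h.2)) &
      forall g, G g -> g.2 <= p g.1].

Lemma sublinear0 : p 0 = 0.
Proof. by rewrite -(scale0r 0) pZ// mul0r. Qed.

Lemma dominated_graph_inj G x r s :
  dominated_graph G -> G (x, r) -> G (x, s) -> r = s.
Proof.
move=> [_ GL Gp].
suff le r' s' : G (x, r') -> G (x, s') -> r' <= s'.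
  by move=> xr xs; apply/eqP; rewrite eq_le !le.
move=> xr xs; have /Gp /= := GL (-1) _ _ xs xr.
by rewrite scaleN1r addNr sublinear0; lra.
Qed.

(** The one-dimensional step: sublinearity leaves room for a value at [x0] between
    the constraints coming from [x0] and from [- x0]. *)
Lemma dominated_graph_extend G x0 : dominated_graph G ->
  exists2 G', dominated_graph G' & G `<=` G' /\ exists r, G' (x0, r).
Proof.
move=> [G0 GL Gp].
pose S := [set g.2 - p (g.1 - x0) | g in G].
have SP g h : G g -> G h -> g.2 - p (g.1 - x0) <= p (h.1 + x0) - h.2.
  move=> Gg Gh; have /Gp /= := GL 1 _ _ Gg Gh; rewrite scale1r mul1r.
  have := pD (g.1 - x0) (h.1 + x0); rewrite addrACA addNr addr0; lra.
(* Every element of S is at most every p (h.1 + x0) - h.2, and the value at x0 may be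
   any number in between. *)
have Ssup : has_sup S.
  split; first by exists (0 - p (0 - x0)), 0.
  by exists (p (0 + x0) - 0) => _ [g Gg <-]; exact: (SP g 0).
pose a := sup S.
have lea g : G g -> g.2 - p (g.1 - x0) <= a.
  by move=> Gg; apply: (ub_le_sup Ssup.2); exists g.
have age h : G h -> a <= p (h.1 + x0) - h.2.
  by move=> Gh; apply: (ge_sup Ssup.1) => _ [g Gg <-]; exact: SP.
have GZ b g : G g -> G (b *: g.1, b * g.2).
  by move=> Gg; have := GL b _ _ Gg G0; rewrite /= !addr0.
exists [set g | exists2 h, G h & exists t, g = (h.1 + t *: x0, h.2 + t * a)].
  split.
  - by exists 0 => //; exists 0; rewrite scale0r mul0r !addr0.
  - move=> b _ _ [g Gg [s ->]] [h Gh [t ->]] /=.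
    exists (b *: g.1 + h.1, b * g.2 + h.2); first exact: GL.
    exists (b * s + t) => /=; congr (_, _); last by ring.
    by rewrite scalerDl scalerDr scalerA addrACA.
  - move=> _ [g Gg [t ->]] /=.
    have [t0|t0|->] := ltgtP t 0; last by rewrite scale0r mul0r !addr0; exact: Gp.
    + have /lea /= := GZ (- t)^-1 _ Gg.
      have nt : 0 < - t by rewrite oppr_gt0.
      rewrite -(ler_pM2l nt) mulrBr mulVKf ?gt_eqF// -pZ ?(ltW nt)//.
      rewrite scalerBr scalerA mulfV ?gt_eqF// scale1r scaleNr opprK; lra.
    + have /age /= := GZ t^-1 _ Gg.
      rewrite -(ler_pM2l t0) mulrBr mulVKf ?gt_eqF// -pZ ?(ltW t0)//.
      by rewrite scalerDr scalerA mulfV ?gt_eqF// scale1r; lra.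
split.
  by move=> g Gg; exists g => //; exists 0; rewrite scale0r mul0r !addr0; case: g Gg.
by exists a, 0 => //; exists 1; rewrite scale1r mul1r !add0r.
Qed.

(** The functional is given along a map [phi] instead of on a subspace, which is how
    all the extensions below arise; the hypothesis makes [f] factor through [phi]. *)
Theorem hahn_banach (E : lmodType R) (phi : {linear E -> V}) (f : {scalar E}) :
  (forall x, f x <= p (phi x)) ->
  exists2 g : {scalar V}, (forall x, g (phi x) = f x) & forall v, g v <= p v.
Proof.
move=> fp; pose G0 : set (V * R) := [set (phi x, f x : R) | x in setT].
have G0P : dominated_graph G0.
  split; first by exists 0; rewrite ?linear0.
    move=> a _ _ [x _ <-] [y _ <-] /=; exists (a *: x + y) => //.
    by rewrite !linearP.
  by move=> _ [x _ <-]; exact: fp.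
(* The graph G0 is kept apart from the varying part so that the empty chain has an
   upper bound. *)
have [F FP totF|A [AP Amax]] := @Zorn_bigcup _ (fun G => dominated_graph (G0 `|` G)).
  split; first by left; case: G0P.
    move=> a g h Fg Fh.
    have [G [Gg Gh GP GF]] : exists G, [/\ (G0 `|` G) g, (G0 `|` G) h,
        dominated_graph (G0 `|` G) & (G = set0 \/ F G)].
      case: Fg Fh => [Gg|[X FX Xg]] [Gh|[Y FY Yh]].
      - by exists set0; split; [left|left|rewrite setU0|left].
      - by exists Y; split; [left|right|exact: FP|right].
      - by exists X; split; [right|left|exact: FP|right].
      - have [XY|YX] := totF _ _ FX FY.
          by exists Y; split; [right; exact: XY|right|exact: FP|right].
        by exists X; split; [right|right; exact: YX|exact: FP|right].
    have [_ /(_ a g h Gg Gh) + _] := GP.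
    by case=> [|Gx]; [left|right; case: GF => [G0e|FG]; [rewrite G0e in Gx|exists G]].
  move=> g [|[X FX Xg]]; first by case: G0P => _ _; exact.
  by have [_ _] := FP _ FX; apply; right.
have Adom v : exists r, (G0 `|` A) (v, r).
  have [B BP [AB [r Br]]] := dominated_graph_extend v AP; exists r.
  apply: contrapT => nA; apply: (Amax B); last first.
    rewrite (_ : _ `|` _ = B)//; apply/seteqP; split=> [x [G0x|//]|x]; last by right.
    by apply: AB; left.
  split=> [x Ax|BA]; first by apply: AB; right.
  by apply: nA; right; apply: BA.
pose g v := projT1 (cid (Adom v)).
have gA v : (G0 `|` A) (v, g v) by exact: (projT2 (cid (Adom v))).
have gP : scalar g.
  move=> a u v; apply: (dominated_graph_inj AP (gA _)).
  by have [_ /(_ a (u, g u) (v, g v) (gA u) (gA v))] := AP.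
exists (mk_scalar gP) => [x|v].
  by apply: (dominated_graph_inj AP (gA _)); left; exists x.
by have [_ _ /(_ _ (gA v))] := AP.
Qed.

End HahnBanach.

(** A functional that norms [x], from Hahn-Banach on the line through [x]. *)
Lemma seminorm_support {R : realType} {V : lmodType R} (p : V -> R) (x : V) :
  seminorm p -> exists2 f : {scalar V}, f x = p x & forall v, `|f v| <= p v.
Proof.
move=> pS; have pZ t v : 0 <= t -> p (t *: v) = t * p v.
  by move=> t0; rewrite pS.2 ger0_norm.
have phiP : linear (fun t : R^o => t *: x) by move=> a u v; rewrite scalerDl scalerA.
have fP : scalar (fun t : R^o => t * p x) by move=> a u v; rewrite mulrDl mulrA.
have fp t : mk_scalar fP t <= p (mk_linear phiP t).
  by rewrite [leRHS]pS.2 ler_wpM2r ?ler_norm// (seminorm_ge0 pS).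
have [f fx fle] := hahn_banach pS.1 pZ fp.
exists f => [|v]; first by have := fx 1; rewrite /= scale1r mul1r.
rewrite ler_norml fle andbT lerNl.
have -> : - f v = f (- v) by rewrite linearN.
by rewrite -(seminormN pS).
Qed.

(** * Euclidean spaces *)

Section EuclideanFacts.
Context {R : realType} {E : euclideanType R}.
Implicit Types (x y : E).

Lemma dotNl x y : dot (- x) y = - dot x y :> R.
Proof. by rewrite -scaleN1r dotZl mulN1r. Qed.

Lemma dotNr x y : dot x (- y) = - dot x y :> R.
Proof. by rewrite dotC dotNl dotC. Qed.

Lemma dot_sumr n (F : 'I_n -> E) x : dot x (\sum_k F k) = \sum_k dot x (F k) :> R.
Proof.
rewrite dotC -/(dotr x _) linear_sum.
by apply: eq_bigr => k _; rewrite /dotr dotC.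
Qed.

(** The Cauchy-Schwarz inequality. *)
Lemma dot_le x y : `|dot x y| <= `|x| * `|y| :> R.
Proof.
suff le (z w : E) : dot z w <= `|z| * `|w| :> R.
  have := le (- x) y; have := le x y; rewrite dotNl normrN ler_norml; lra.
have [->|w0] := eqVneq w 0; first by rewrite normr0 mulr0 dotC dot0l.
have w0' : 0 < `|w| by rewrite normr_gt0.
have [->|z0] := eqVneq z 0; first by rewrite normr0 mul0r dot0l.
have z0' : 0 < `|z| by rewrite normr_gt0.
(* The expansion of this square is 2 |z| |w| (|z| |w| - <z, w>). *)
have : 0 <= `| `|w| *: z - `|z| *: w| ^+ 2 by rewrite exprn_ge0.
rewrite -dot_norm dotDl !dotDr !dotNl !dotNr opprK !dotZl !dotZr (dotC w z).
rewrite !dot_norm => h.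
have {h} : 0 <= (`|z| * `|w|) * (`|z| * `|w| - dot z w) by nra.
by rewrite pmulr_rge0 ?mulr_gt0// subr_ge0.
Qed.

Lemma riesz (f : {scalar E}) : exists y, forall x, f x = dot x y.
Proof.
have [n [e [_ eE]]] := orthonormal_basis E.
exists (\sum_i f (e i) *: e i) => x.
rewrite dot_sumr {1}[x]eE linear_sum; apply: eq_bigr => i _.
by rewrite linearZ dotZr mulrC.
Qed.

(** Finite dimension enters here: on an orthonormal basis [p] takes finitely many
    values, and the coordinates are bounded by the norm. *)
Lemma seminorm_bound (p : E -> R) : seminorm p ->
  exists2 C, 0 < C & forall x, p x <= C * `|x|.
Proof.
move=> pS; have [n [e [eo eE]]] := orthonormal_basis E.
exists (1 + \sum_i p (e i)).
  by rewrite ltr_pwDl// sumr_ge0// => i _; exact: seminorm_ge0.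
move=> x; rewrite {1}[x]eE mulrDl mul1r (le_trans (seminorm_sum pS _))//.
rewrite mulr_suml ler_wpDl//; apply: ler_sum => i _.
rewrite pS.2 mulrC ler_wpM2l ?(seminorm_ge0 pS)//.
rewrite (le_trans (dot_le _ _))// ler_piMr//.
have : `|e i| ^+ 2 = 1 :> R by rewrite -dot_norm eo eqxx.
by move=> /eqP; rewrite sqrp_eq1// => /eqP ->.
Qed.

Lemma seminorm_continuous (p : E -> R) : seminorm p -> continuous (p : E -> R^o).
Proof.
move=> pS x; have [C C0 pC] := seminorm_bound pS.
apply/cvgrPdist_lt => e e0; near=> y.
have lt : `|x - y| < e / C.
  by near: y; apply: cvgr_dist_lt; rewrite ?divr_gt0//; exact: cvg_id.
have {}lt : p (x - y) < e.
  by rewrite (le_lt_trans (pC _))// mulrC -ltr_pdivlMr.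
rewrite ltr_norml; apply/andP; split.
  have := pS.1 (y - x) x; rewrite subrK -opprB (seminormN pS); lra.
by have := pS.1 (x - y) y; rewrite subrK; lra.
Unshelve. all: by end_near. Qed.

Lemma seminorm_closed (p : E -> R) : seminorm p -> closed [set x | p x <= 1].
Proof.
move=> pS; apply: (@preimage_closed _ _ (p : E -> R^o) [set r | r <= 1]).
  by move=> x _; exact: seminorm_continuous.
exact: closed_le.
Qed.

(** A bounded closed set is the continuous image of a bounded closed set of coordinate
    vectors. *)
Lemma heine_borel (K : set E) (M : R) :
  closed K -> (forall x, K x -> `|x| <= M) -> compact K.
Proof.
move=> Kc KM; have [n [e [eo eE]]] := orthonormal_basis E.
have e1 i : `|e i| = 1 :> R.
  have : `|e i| ^+ 2 = 1 :> R by rewrite -dot_norm eo eqxx.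
  by move=> /eqP; rewrite sqrp_eq1// => /eqP ->.
pose f (v : 'rV[R]_n) := \sum_i v 0 i *: e i.
have fP : linear f.
  move=> a u v; rewrite /f scaler_sumr -big_split/=; apply: eq_bigr => i _.
  by rewrite !mxE scalerDl scalerA.
have entry (v : 'rV[R]_n) i : `|v 0 i| <= `|v|.
  rewrite [leRHS]/Num.norm /= mx_normrE; apply/bigmax_geP; right => /=.
  by exists (0, i).
have fC : continuous f.
  apply: (bounded_linear_continuous (f := mk_linear fP)).
  apply/linear_boundedP.
  apply: filterS (nbhs_pinfty_ge (num_real (n%:R : R))) => r nr v.
  rewrite (le_trans (ler_norm_sum _ _ _))//.
  rewrite (@le_trans _ _ (\sum_(i < n) `|v|))//.
    by apply: ler_sum => i _; rewrite normrZ e1 mulr1 entry.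
  rewrite sumr_const card_ord -mulr_natl; exact: ler_wpM2r.
have {1}-> : K = f @` (f @^-1` K).
  apply/seteqP; split=> [x Kx|_ [v Kv <-]//].
  have fx : f (\row_i dot x (e i)) = x.
    by rewrite [RHS]eE; apply: eq_bigr => i _; rewrite mxE.
  by exists (\row_i dot x (e i)); rewrite /= ?fx.
apply: continuous_compact; first exact: continuous_subspaceT.
apply: bounded_closed_compact.
  exists (`|M|); split; first by rewrite num_real.
  move=> r Mr v Kv; rewrite /Num.norm/= mx_normrE; apply/bigmax_leP; split=> /=.
    by rewrite (le_trans _ (ltW Mr)).
  move=> [i0 i] _ /=; rewrite (ord1 i0).
  have -> : v 0 i = dot (f v) (e i) :> R.
    rewrite dotC dot_sumr (bigD1 i)//= dotZr eo eqxx mulr1 big1 ?addr0// => j ji.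
    by rewrite dotZr eo eq_sym (negbTE ji) mulr0.
  rewrite (le_trans (dot_le _ _))// e1 mulr1 (le_trans (KM _ Kv))//.
  by rewrite (le_trans (ler_norm _))// ltW.
by apply: preimage_closed => // x _; exact: fC.
Qed.

(** Reduces weak inequalities for gauges to strict ones. *)
Lemma closed_ray (K : set E) x :
  closed K -> (forall u : R, 0 < u -> u < 1 -> K (u *: x)) -> K x.
Proof.
move=> Kc Kx; apply: Kc => B /nbhs_ballP[e /= e0 eB].
pose d := Num.min 2^-1 (e / (`|x| + 1)).
have x0 : 0 < `|x| + 1 by rewrite ltr_wpDl.
have d0 : 0 < d by rewrite lt_min invr_gt0 ltr0n/= divr_gt0.
have d1 : d <= 2^-1 by rewrite /d ge_min lexx.
have de : d <= e / (`|x| + 1) by rewrite /d ge_min lexx orbT.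
exists ((1 - d) *: x); split; first by apply: Kx; lra.
apply: eB; rewrite -ball_normE /= scalerBl scale1r opprB addrC subrK normrZ.
rewrite ger0_norm ?(ltW d0)//.
move: de; rewrite ler_pdivlMr// mulrDr mulr1; lra.
Qed.

End EuclideanFacts.

(** * Gauges and polars of convex bodies *)

Section ConvexBodyFacts.
Context {R : realType} {E : euclideanType R}.
Implicit Types (x y : E) (P : set E).

(** Convexity with scalars in the field in place of the interval type. *)
Lemma convex_setE P : convex_set (P : set (convex_lmodType E)) <->
  forall x y (t : R), 0 <= t -> t <= 1 -> P x -> P y -> P (t *: x + (1 - t) *: y).
Proof.
split=> [cP x y t t0 t1 Px Py|cP x y t].
  exact/set_mem/(cP x y (Itv01 t0 t1) (mem_set Px) (mem_set Py)).
move=> /set_mem Px /set_mem Py; apply/mem_set/cP => //.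
Qed.

Lemma polarP P y : polar P y <-> forall x, P x -> dot x y <= 1 :> R.
Proof.
rewrite /polar/=; split=> [h x Px|h].
  rewrite -lee_fin (le_trans _ h)//.
  by apply: ereal_sup_ubound; exists x.
by apply: ge_ereal_sup => _ [x Px <-]; rewrite lee_fin h.
Qed.

Lemma polar_anti P P' : P `<=` P' -> polar P' `<=` polar P.
Proof. by move=> PP y /polarP yP; apply/polarP => x /PP /yP. Qed.

Lemma sub_polar2 P : P `<=` polar (polar P).
Proof. by move=> x Px; apply/polarP => y /polarP/(_ x Px); rewrite dotC. Qed.

Section UnitBallOfNorm.
Variable p : E -> R.
Hypothesis pS : seminorm p.

Lemma seminorm_convex : convex_set ([set x | p x <= 1] : set (convex_lmodType E)).
Proof.
apply/convex_setE => x y t t0 t1 /= px py.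
rewrite (le_trans (pS.1 _ _))// !pS.2 !ger0_norm ?subr_ge0//.
have := ler_wpM2l t0 px; have := ler_wpM2l _ py; have : 0 <= 1 - t by lra.
by move=> h /(_ _ h); lra.
Qed.

(** The lower bound gives boundedness, hence compactness; the interior comes from the
    upper bound that holds for every seminorm. *)
Lemma seminorm_body (c : R) : 0 < c -> (forall x, c * `|x| <= p x) ->
  sym_convex_body [set x | p x <= 1].
Proof.
move=> c0 cp; split.
- apply: (@heine_borel _ _ _ c^-1) => [|x /= px]; first exact: seminorm_closed.
  by rewrite -[leRHS]mul1r ler_pdivlMr// mulrC (le_trans (cp x)).
- exact: seminorm_convex.
- have [C C0 pC] := seminorm_bound pS.
  exists 0; apply/nbhs_ballP; exists C^-1 => /=; first by rewrite invr_gt0.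
  move=> x; rewrite -ball_normE /= sub0r normrN => /ltW xC.
  by rewrite (le_trans (pC x))// mulrC -ler_pdivlMr// mul1r.
- apply/seteqP; split=> [_ [x px <-]|x px] /=; first by rewrite seminormN.
  by exists (- x); rewrite ?opprK//= seminormN.
Qed.

Lemma seminorm_gauge : gauge [set x | p x <= 1] = p.
Proof.
apply/funext => x; rewrite /gauge.
have rP (r : R) : 0 < r -> (p (r^-1 *: x) <= 1) = (p x <= r).
  move=> r0; rewrite pS.2 gtr0_norm ?invr_gt0//.
  by rewrite mulrC ler_pdivrMr// mul1r.
set S := [set r | _].
have Slb : lbound S (p x) by move=> r [r0] /=; rewrite rP.
apply/eqP; rewrite eq_le; apply/andP; split.
  apply/ler_addgt0Pr => e e0; apply: ge_inf; first by exists (p x).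
  have pe : 0 < p x + e by rewrite ltr_wpDl// (seminorm_ge0 pS).
  by split=> //=; rewrite rP// lerDl ltW.
apply: lb_le_inf => //; exists (p x + 1); split=> /=.
  by rewrite ltr_wpDl// (seminorm_ge0 pS).
by rewrite rP ?lerDl// ltr_wpDl// (seminorm_ge0 pS).
Qed.

End UnitBallOfNorm.

Section Body.
Variable P : set E.
Hypothesis PB : sym_convex_body P.

Lemma body_sym x : P x -> P (- x).
Proof. by move=> Px; case: PB => _ _ _ <-; exists x. Qed.

Lemma body_convex x y (t : R) :
  0 <= t -> t <= 1 -> P x -> P y -> P (t *: x + (1 - t) *: y).
Proof. by case: PB => _ /convex_setE + _ _; exact. Qed.

Lemma body_closed : closed P.
Proof. by case: PB => Pc _ _ _; apply: compact_closed => //; exact: norm_hausdorff. Qed.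

Lemma body_bounded : exists2 M : R, 0 < M & forall x, P x -> `|x| <= M.
Proof.
case: PB => /compact_bounded[M [Mr MP]] _ _ _.
exists (`|M| + 1); first by rewrite ltr_wpDl.
by move=> x Px; apply: MP => //; rewrite (le_lt_trans (ler_norm _))// ltrDl.
Qed.

(** The midpoints between a ball in [P] and its mirror image fill a ball about the
    origin. *)
Lemma body_ball : exists2 r : R, 0 < r & forall x, `|x| <= r -> P x.
Proof.
case: PB => _ _ [x0 /nbhs_ballP[e /= e0 eP]] _.
exists (e / 2); first by rewrite divr_gt0.
move=> x xe.
have P1 : P (x0 + x).
  apply: eP; rewrite -ball_normE /= opprD addNKr normrN.
  by rewrite (le_lt_trans xe)// ltr_pdivrMr// mulr_natr mulr2n ltrDl.
have P2 : P (- x0 + x).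
  rewrite -[_ + x]opprK opprD opprK; apply: body_sym; apply: eP.
  rewrite -ball_normE /= opprB addrC subrK.
  by rewrite (le_lt_trans xe)// ltr_pdivrMr// mulr_natr mulr2n ltrDl.
(* x is the midpoint of two points of P close to x0 and to - x0. *)
have -> : x = 2^-1 *: (x0 + x) + (1 - 2^-1) *: (- x0 + x).
  have -> : 1 - 2^-1 = 2^-1 :> R by lra.
  by rewrite -scalerDr addrACA subrr add0r -mulr2n -scalerMnr scalerMnl -mulr_natr mulVf ?scale1r.
by apply: body_convex => //; lra.
Qed.

Lemma body0 : P 0.
Proof. by have [r r0] := body_ball; apply; rewrite normr0 ltW. Qed.

Lemma body_shrink x (t : R) : 0 <= t -> t <= 1 -> P x -> P (t *: x).
Proof.
by move=> t0 t1 Px; have := body_convex t0 t1 Px body0; rewrite scaler0 addr0.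
Qed.

Let S x := [set r : R | 0 < r /\ P (r^-1 *: x)].

Let S_inf x : has_inf (S x).
Proof.
split; last by exists 0 => r [/ltW].
have [r r0 rP] := body_ball.
have x1 : 0 < `|x| + 1 by rewrite ltr_wpDl.
exists ((`|x| + 1) / r); split; first by rewrite divr_gt0.
apply: rP; rewrite normrZ gtr0_norm ?invr_gt0 ?divr_gt0// invf_div.
rewrite mulrAC ler_pdivrMr//; apply: ler_wpM2l; first exact: ltW.
by rewrite lerDl.
Qed.

(** Closedness of [P] makes the infimum in the gauge attained. *)
Lemma body_gaugeP x (t : R) : 0 < t -> (P (t^-1 *: x) <-> gauge P x <= t).
Proof.
move=> t0; split=> [Px|gt]; first by apply: ge_inf; [exists 0 => r [/ltW]|split].
apply: (closed_ray body_closed) => u u0 u1.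
have [r [r0 Pr] rt] : exists2 r, S x r & r < t / u.
  apply: inf_lt; first exact: (S_inf x).1.
  by rewrite (le_lt_trans gt)// ltr_pdivlMr// gtr_pMr.
have -> : u *: (t^-1 *: x) = (u * r / t) *: (r^-1 *: x).
  by rewrite !scalerA; congr (_ *: _); field; rewrite !gt_eqF.
apply: body_shrink => //; first by rewrite divr_ge0 ?mulr_ge0 ?ltW.
by rewrite ler_pdivrMr// mul1r mulrC -ler_pdivlMr// ltW.
Qed.

Lemma body_gauge1 x : P x <-> gauge P x <= 1.
Proof. by rewrite -body_gaugeP// invr1 scale1r. Qed.

Lemma gauge_ge0 x : 0 <= gauge P x.
Proof. by apply: lb_le_inf; [exact: (S_inf x).1|move=> r [/ltW]]. Qed.

Lemma body_gauge_seminorm : seminorm (gauge P).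
Proof.
have g0 : gauge P 0 = 0.
  apply/eqP; rewrite eq_le gauge_ge0 andbT; apply/ler_addgt0Pr => e e0.
  by rewrite add0r -body_gaugeP// scaler0; exact: body0.
have gZ a x : gauge P (a *: x) <= `|a| * gauge P x.
  have [->|a0] := eqVneq a 0; first by rewrite scale0r g0 normr0 mul0r.
  have a0' : 0 < `|a| by rewrite normr_gt0.
  rewrite -ler_pdivrMl//; apply/ler_addgt0Pr => e e0; rewrite ler_pdivrMl//.
  have ge : 0 < gauge P x + e by rewrite ltr_wpDl// gauge_ge0.
  apply/body_gaugeP; first exact: mulr_gt0.
  have Pe : P ((gauge P x + e)^-1 *: x) by apply/body_gaugeP; rewrite // lerDl ltW.
  have [ap|an] := ltP 0 a.
    rewrite gtr0_norm// scalerA invfM mulrAC mulVf// mul1r; exact: Pe.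
  rewrite ler0_norm// scalerA invfM mulrAC invrN mulNr mulVf// mulN1r scaleNr.
  exact: body_sym.
split=> [x y|a x].
  apply/ler_addgt0Pr => e e0.
  pose s := gauge P x + e / 2; pose t := gauge P y + e / 2.
  have s0 : 0 < s by rewrite ltr_wpDl ?gauge_ge0// divr_gt0.
  have t0 : 0 < t by rewrite ltr_wpDl ?gauge_ge0// divr_gt0.
  have -> : gauge P x + gauge P y + e = s + t by rewrite /s /t; lra.
  have st : 0 < s + t by rewrite addr_gt0.
  apply/body_gaugeP => //.
  have -> : (s + t)^-1 *: (x + y) =
      (s / (s + t)) *: (s^-1 *: x) + (1 - s / (s + t)) *: (t^-1 *: y).
    rewrite scalerDr !scalerA; congr (_ *: _ + _ *: _); field;
    by rewrite ?gt_eqF.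
  apply: body_convex; first by rewrite divr_ge0 ?ltW.
  - by rewrite ler_pdivrMr// mul1r lerDl ltW.
  - by apply/body_gaugeP => //; rewrite lerDl divr_ge0 ?ltW.
  - by apply/body_gaugeP => //; rewrite lerDl divr_ge0 ?ltW.
apply/eqP; rewrite eq_le gZ/=; have [->|a0] := eqVneq a 0.
  by rewrite normr0 mul0r gauge_ge0.
have := gZ a^-1 (a *: x); rewrite scalerA mulVf// scale1r normfV.
by rewrite ler_pdivlMl ?normr_gt0.
Qed.

Lemma body_gauge_lb : exists2 c : R, 0 < c & forall x, c * `|x| <= gauge P x.
Proof.
have [M M0 MP] := body_bounded; exists M^-1; first by rewrite invr_gt0.
move=> x; apply/ler_addgt0Pr => e e0.
have ge : 0 < gauge P x + e by rewrite ltr_wpDl// gauge_ge0.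
have /MP : P ((gauge P x + e)^-1 *: x) by apply/body_gaugeP; rewrite // lerDl ltW.
by rewrite normrZ gtr0_norm ?invr_gt0// ler_pdivrMl// mulrC -ler_pdivrMl.
Qed.

Lemma body_gauge_eq0 x : gauge P x = 0 -> x = 0.
Proof.
have [c c0 /(_ x) + gx] := body_gauge_lb.
by rewrite gx pmulr_rle0// normr_le0 => /eqP.
Qed.

Lemma polar_gauge y : polar P y <-> forall x, dot x y <= gauge P x :> R.
Proof.
rewrite polarP; split=> h x; last by move=> /body_gauge1; exact: le_trans.
apply/ler_addgt0Pr => e e0.
have ge : 0 < gauge P x + e by rewrite ltr_wpDl// gauge_ge0.
have /h : P ((gauge P x + e)^-1 *: x) by apply/body_gaugeP; rewrite // lerDl ltW.
by rewrite dotZl ler_pdivrMl// mulr1.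
Qed.

Lemma polar_gauge_norm y x : polar P y -> `|dot x y : R| <= gauge P x.
Proof.
move=> /polar_gauge yP; rewrite ler_norml lerNl -dotNl yP andbT.
by rewrite -(seminormN body_gauge_seminorm) yP.
Qed.

Lemma polar_body : sym_convex_body (polar P).
Proof.
have [r r0 rP] := body_ball; have [M M0 MP] := body_bounded.
have PE y : polar P y <-> forall x, P x -> `|dot x y : R| <= 1.
  rewrite polarP; split=> h x Px; last by rewrite (le_trans (ler_norm _)) ?h.
  by rewrite ler_norml lerNl -dotNl !h//; exact: body_sym.
have dS x : seminorm (fun y => `|dot x y : R|).
  by split=> [y z|a y]; [rewrite dotDr ler_normD|rewrite dotZr normrM].
split.
- apply: (@heine_borel _ _ _ r^-1).
    rewrite (_ : polar P = \bigcap_(x in P) [set y | `|dot x y : R| <= 1]).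
      by apply: closed_bigI => x Px; exact: seminorm_closed.
    by apply/seteqP; split=> y /PE.
  move=> y /PE yP; have [->|y0] := eqVneq y 0; first by rewrite normr0 invr_ge0 ltW.
  have y0' : 0 < `|y| by rewrite normr_gt0.
  have /yP : P ((r / `|y|) *: y).
    apply: rP; rewrite normrZ gtr0_norm ?divr_gt0// -mulrA mulVf ?mulr1//.
    by rewrite gt_eqF.
  rewrite dotZl dot_norm expr2 -mulrA mulKf ?gt_eqF//.
  by rewrite gtr0_norm ?mulr_gt0// mulrC -ler_pdivlMr// div1r.
- apply/convex_setE => y z t t0 t1 /polarP yP /polarP zP; apply/polarP => x Px.
  rewrite dotDr !dotZr; have := yP x Px; have := zP x Px; nra.
- exists 0; apply/nbhs_ballP; exists M^-1 => /=; first by rewrite invr_gt0.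
  move=> y; rewrite -ball_normE /= sub0r normrN => /ltW yM.
  apply/polarP => x /MP xM; rewrite (le_trans (ler_norm _))// (le_trans (dot_le _ _))//.
  by rewrite -(@mulfV _ M) ?gt_eqF// ler_pM.
- apply/seteqP; split=> [_ [y /PE yP <-]|y /PE yP].
    by apply/PE => x Px; rewrite dotNr normrN yP.
  exists (- y); rewrite ?opprK//=.
  by apply/PE => x Px; rewrite dotNr normrN yP.
Qed.

(** Outside [P] the gauge exceeds 1, and a functional that norms the point for the
    gauge lies in the polar and separates. *)
Lemma bipolar : polar (polar P) = P.
Proof.
apply/seteqP; split; last exact: sub_polar2.
move=> x0 /polarP xP; apply/body_gauge1.
have [f fx fle] := seminorm_support x0 body_gauge_seminorm.
have [y fy] := riesz f.
have yP : polar P y.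
  by apply/polar_gauge => x; rewrite -fy (le_trans (ler_norm _)).
by rewrite -fx fy dotC xP.
Qed.

End Body.
End ConvexBodyFacts.

(** * The projective norm *)

Section TensorFacts.
Context {R : realType} {l : nat}.

Section One.
Context {V : 'I_l -> lmodType R}.

Lemma tens_linear (v : forall i, V i) i (a : R) (x y : V i) :
  tens (dfwith v (a *: x + y)) = a *: tens (dfwith v x) + tens (dfwith v y).
Proof. by apply: tensor_ext => f; rewrite [LHS]mformP. Qed.

Lemma dfwith_self (v : forall i, V i) i : dfwith v (v i) = v.
Proof. by apply: functional_extensionality_dep => j; case: dfwithP. Qed.

Lemma tensZ (v : forall i, V i) i (a : R) :
  a *: tens v = tens (dfwith v (a *: v i)).
Proof.
apply: tensor_ext => f.
have := mformP f v a (v i) 0; have := mformP f v 1 (0 : V i) 0.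
rewrite !addr0 scaler0 mul1r dfwith_self => h.
have {h} -> : f (dfwith v (0 : V i)) = 0 by lra.
by rewrite addr0 => fE; rewrite [RHS]fE.
Qed.

Lemma tens_eq0 (v : forall i, V i) i : v i = 0 -> tens v = 0.
Proof. by move=> vi; rewrite -(scale0r (tens v)) (tensZ _ i) scale0r -{1}vi dfwith_self. Qed.

Lemma tensor_sum_tens (u : tensor V) : (0 < l)%N ->
  exists n (x : 'I_n -> forall i, V i), u = \sum_(k < n) tens (x k).
Proof.
move=> l0; have [n [c [x ->]]] := tensor_span u.
exists n, (fun k => dfwith (x k) (c k *: x k (Ordinal l0))).
by apply: eq_bigr => k _; rewrite -tensZ.
Qed.

End One.

Lemma tensor_map_comp {V W U : 'I_l -> lmodType R} (T : forall i, {linear V i -> W i})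
    (S : forall i, {linear W i -> U i}) (Q : forall i, {linear V i -> U i}) u :
  (forall i x, S i (T i x) = Q i x) ->
  tensor_map S (tensor_map T u) = tensor_map Q u.
Proof.
move=> ST; apply: tensor_ext => f.
change (u (mform_comp T (mform_comp S f)) = u (mform_comp Q f) :> R).
f_equal; apply: mform_ext => x /=; f_equal.
by apply: functional_extensionality_dep => i.
Qed.

Lemma tensor_map_id {V : 'I_l -> lmodType R} (T : forall i, {linear V i -> V i}) u :
  (forall i x, T i x = x) -> tensor_map T u = u.
Proof.
move=> TE; apply: tensor_ext => f; change (u (mform_comp T f) = u f :> R).
f_equal; apply: mform_ext => x /=; f_equal.
by apply: functional_extensionality_dep => i.
Qed.

Section ProjectiveNorm.
Context {X : 'I_l -> normedModType R} (l_gt0 : (0 < l)%N).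
Let XX := tensor (fun i => X i : lmodType R).
Local Notation N := (@projective_norm R l X).

Let S (u : XX) := [set s : R | exists n (x : 'I_n -> forall i, X i),
    u = \sum_(k < n) tens (x k) /\ s = \sum_(k < n) \prod_(i < l) `|x k i|].

Lemma projective_norm_le n (x : 'I_n -> forall i, X i) :
  N (\sum_(k < n) tens (x k)) <= \sum_(k < n) \prod_(i < l) `|x k i|.
Proof.
apply: ge_inf; last by exists n, x.
exists 0 => _ [m [y [_ ->]]]; apply: sumr_ge0 => k _.
by apply: prodr_ge0 => i _.
Qed.

Lemma le_projective_norm (m : R) (u : XX) :
  (forall n (x : 'I_n -> forall i, X i), u = \sum_(k < n) tens (x k) ->
    m <= \sum_(k < n) \prod_(i < l) `|x k i|) -> m <= N u.
Proof.
move=> um; apply: lb_le_inf; last by move=> _ [n [x [ux ->]]]; exact: um.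
have [n [x ux]] := tensor_sum_tens u l_gt0.
by exists (\sum_(k < n) \prod_(i < l) `|x k i|), n, x.
Qed.

(** The projective norm is the largest seminorm with the given values on elementary
    tensors; all upper bounds by the projective norm are obtained in this way. *)
Lemma projective_norm_max (p : XX -> R) (c : R) : seminorm p -> 0 <= c ->
  (forall x, p (tens x) <= c * \prod_i `|x i|) -> forall u, p u <= c * N u.
Proof.
move=> pS c0 pt u.
have le n (x : 'I_n -> forall i, X i) : u = \sum_(k < n) tens (x k) ->
    p u <= c * \sum_(k < n) \prod_(i < l) `|x k i|.
  move=> ->; rewrite (le_trans (seminorm_sum pS _))// mulr_sumr.
  by apply: ler_sum => k _.
move: c0; rewrite le_eqVlt => /predU1P[c0|c0].
  by have [n [x /le]] := tensor_sum_tens u l_gt0; rewrite -c0 !mul0r.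
rewrite -ler_pdivrMl//; apply: le_projective_norm => n x /le.
by rewrite ler_pdivrMl.
Qed.

Lemma projective_norm_tens x : N (tens x) <= \prod_i `|x i|.
Proof. by have := @projective_norm_le 1 (fun=> x); rewrite !big_ord1. Qed.

Lemma projective_norm_seminorm : seminorm N.
Proof.
have NZ a u : N (a *: u) <= `|a| * N u.
  have [->|a0] := eqVneq a 0.
    rewrite scale0r normr0 mul0r.
    by have := @projective_norm_le 0 (fun=> fun=> 0); rewrite !big_ord0.
  rewrite -ler_pdivrMl ?normr_gt0//; apply: le_projective_norm => n x ->.
  rewrite ler_pdivrMl ?normr_gt0// scaler_sumr.
  pose i0 := Ordinal l_gt0.
  under eq_bigr do rewrite (tensZ _ i0).
  rewrite (le_trans (projective_norm_le _))// mulr_sumr.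
  apply: ler_sum => k _; rewrite (bigD1 i0)//= dfwith_in normrZ -mulrA.
  rewrite [X in _ <= _ * X](bigD1 i0)//= ler_wpM2l// ler_wpM2l// le_eqVlt; apply/orP; left; apply/eqP.
  by apply: eq_bigr => i ii0; rewrite dfwith_out// eq_sym.
split=> [u v|a u].
  rewrite -lerBlDr; apply: le_projective_norm => n x ->.
  rewrite lerBlDr [leRHS]addrC -lerBlDr; apply: le_projective_norm => m y ->.
  rewrite lerBlDr.
  pose z k := match fintype.split k with inl i => x i | inr j => y j end.
  have := @projective_norm_le (n + m) z; rewrite !big_split_ord/=.
  rewrite [X in N (X + _) <= _ -> _](eq_bigr (fun k => tens (x k))); last first.
    by move=> k _; rewrite /z (unsplitK (inl k)).
  rewrite [X in N (_ + X) <= _ -> _](eq_bigr (fun k => tens (y k))); last first.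
    by move=> k _; rewrite /z (unsplitK (inr k)).
  move=> /le_trans; apply; rewrite [leRHS]addrC; apply: lerD.
    by apply: ler_sum => k _; rewrite /z (unsplitK (inl k)).
  by apply: ler_sum => k _; rewrite /z (unsplitK (inr k)).
apply/eqP; rewrite eq_le NZ/=; have [->|a0] := eqVneq a 0.
  rewrite normr0 mul0r; apply: le_projective_norm => n x _.
  by apply: sumr_ge0 => k _; apply: prodr_ge0.
have := NZ a^-1 (a *: u); rewrite scalerA mulVf// scale1r normfV.
by rewrite ler_pdivlMl ?normr_gt0.
Qed.

End ProjectiveNorm.

Lemma projective_norm_map {X Y : 'I_l -> normedModType R} (l_gt0 : (0 < l)%N)
    (T : forall i, {linear X i -> Y i}) (u : tensor (fun i => X i : lmodType R)) :
  (forall i x, `|T i x| <= `|x|) ->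
  projective_norm (tensor_map T u : tensor (fun i => Y i : lmodType R)) <=
    projective_norm u.
Proof.
move=> TX; rewrite -[leRHS]mul1r.
apply: (projective_norm_max l_gt0 (p := fun u => projective_norm (tensor_map T u))) => //.
  exact: (seminorm_comp (projective_norm_seminorm l_gt0 (X := Y)) (tensor_map T)).
move=> x; rewrite tensor_map_tens mul1r (le_trans (projective_norm_tens _))//.
by apply: ler_prod => i _; rewrite TX andbT.
Qed.

End TensorFacts.

(** * The space of bounded sequences *)

Section EllInftyFacts.
Context {R : realType}.

Lemma hahn_banach_norm {V : normedModType R} {E : lmodType R}
    (phi : {linear E -> V}) (f : {scalar E}) (c : R) : 0 <= c ->
  (forall x, `|f x| <= c * `|phi x|) ->
  exists2 g : {scalar V}, (forall x, g (phi x) = f x) & forall v, `|g v| <= c * `|v|.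
Proof.
move=> c0 fphi.
have [||x|g gf gc] := @hahn_banach R V (fun v => c * `|v|) _ _ E phi f.
- by move=> x y; rewrite -mulrDr ler_wpM2l// ler_normD.
- by move=> t x t0; rewrite normrZ ger0_norm// mulrCA.
- by rewrite (le_trans (ler_norm _)).
exists g => // v; rewrite ler_norml gc andbT lerNl.
have -> : - g v = g (- v) by rewrite linearN.
by rewrite (le_trans (gc _))// normrN.
Qed.

Lemma ell_infty_ball (x : ell_infty R) n : `|x n : R| <= `|x|.
Proof. exact: ell_infty_norm_ub. Qed.

Lemma ell_infty_ext (x y : ell_infty R) : (forall n, x n = y n :> R) -> x = y.
Proof. by move=> xy; apply: val_inj; apply/funext. Qed.

Lemma mk_ell_infty_subproof {V : lmodType R} (p : V -> R) (g : nat -> {scalar V}) v :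
  (forall n v, `|g n v| <= p v) -> (fun n => g n v : R^o) \in ell_infty_pred.
Proof. by move=> gp; apply/asboolP; exists (p v) => n. Qed.

Definition mk_ell_infty {V : lmodType R} (p : V -> R) (g : nat -> {scalar V})
    (gp : forall n v, `|g n v| <= p v) (v : V) : ell_infty R :=
  EllInfty (mk_ell_infty_subproof v gp).

Lemma mk_ell_infty_linear {V : lmodType R} (p : V -> R) (g : nat -> {scalar V})
  (gp : forall n v, `|g n v| <= p v) : linear (mk_ell_infty gp).
Proof. by move=> a u v; apply: ell_infty_ext => n /=; rewrite linearP. Qed.

(** The injectivity of l_oo: the coordinates are extended one at a time. *)
Lemma ell_infty_extend {V : normedModType R} {E : lmodType R}
    (phi : {linear E -> V}) (T : {linear E -> ell_infty R}) :
  (forall x, `|T x| <= `|phi x|) ->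
  exists2 S : {linear V -> ell_infty R},
    (forall x, S (phi x) = T x) & forall v, `|S v| <= `|v|.
Proof.
move=> Tphi.
have fP n : scalar (fun x => T x n : R) by move=> a x y; rewrite linearP.
have /choice[g gP] n : exists g : {scalar V},
    (forall x, g (phi x) = T x n) /\ forall v, `|g v| <= `|v|.
  have [x|g gf gc] := @hahn_banach_norm V E phi (mk_scalar (fP n)) 1 ler01.
    by rewrite mul1r (le_trans (ell_infty_ball _ _)).
  by exists g; split=> // v; rewrite (le_trans (gc v))// mul1r.
have gp n v : `|g n v| <= `|v| by exact: (gP n).2.
exists (mk_linear (mk_ell_infty_linear gp)) => [x|v].
  by apply: ell_infty_ext => n; exact: (gP n).1.
by apply: (@ell_infty_norm_le R (mk_ell_infty gp v)) => n; exact: gp.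
Qed.

(** Rational combinations of an orthonormal basis. *)
Lemma euclidean_separable (E : euclideanType R) :
  exists d : nat -> E, forall x (e : R), 0 < e -> exists n, `|x - d n| <= e.
Proof.
have [n [b [bo bE]]] := orthonormal_basis E.
pose d k := if (unpickle k : option {ffun 'I_n -> rat}) is Some q
  then \sum_i (ratr (q i) : R) *: b i else 0.
exists d => x e e0.
have [c c0 cE] : exists2 c, 0 < c & c * n.+1%:R = e.
  by exists (e / n.+1%:R); [rewrite divr_gt0|rewrite divfK// pnatr_eq0].
have /choice[q qP] i : exists q : rat, `|dot x (b i) - ratr q| <= c.
  have [|q] := @rat_in_itvoo R (dot x (b i) - c) (dot x (b i) + c); first by lra.
  by rewrite in_itv/= => /andP[q1 q2]; exists q; rewrite ler_norml; lra.
exists (pickle [ffun i => q i]); rewrite /d pickleK.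
rewrite {1}[x]bE -sumrB (le_trans (ler_norm_sum _ _ _))//.
rewrite (@le_trans _ _ (\sum_(i < n) c))//.
  apply: ler_sum => i _; rewrite ffunE -scalerBl normrZ.
  have -> : `|b i| = 1 :> R.
    have : `|b i| ^+ 2 = 1 :> R by rewrite -dot_norm bo eqxx.
    by move=> /eqP; rewrite sqrp_eq1// => /eqP ->.
  by rewrite mulr1.
by rewrite sumr_const card_ord -mulr_natr -cE ler_pM2l// ler_nat.
Qed.

Lemma le_of_mul_lt1 (a t : R) : 0 <= t -> (forall u, 0 < u -> u < 1 -> u * a <= t) -> a <= t.
Proof.
move=> t0 ut; rewrite leNgt; apply/negP => ta.
have a0 : 0 < a by exact: le_lt_trans ta.
have u1 : (t + a) / (2 * a) < 1 by rewrite ltr_pdivrMr ?mulr_gt0// mul1r; lra.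
have u0 : 0 < (t + a) / (2 * a) by rewrite divr_gt0 ?mulr_gt0// ltr_wpDl.
have := ut _ u0 u1.
have -> : (t + a) / (2 * a) * a = (t + a) / 2 by field; rewrite gt_eqF.
lra.
Qed.

(** The coordinates of the embedding are the functionals of a countable dense part of
    the polar; the bipolar theorem shows that they determine the gauge. *)
Lemma body_embedding (E : euclideanType R) (P : set E) : sym_convex_body P ->
  exists j : {linear E -> ell_infty R}, isometric_embedding P j.
Proof.
move=> PB; have PB' := polar_body PB.
have [d dP] := euclidean_separable E.
pose y k := if `[< polar P (d k) >] then d k else 0.
have yP k : polar P (y k).
  by rewrite /y; case: asboolP => // _; exact: body0.
have gp k x : `|dotr (y k) x| <= gauge P x by exact: polar_gauge_norm.
pose j := mk_linear (mk_ell_infty_linear (g := fun k => dotr (y k) : {scalar E}) gp).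
exists j => x; apply/eqP; rewrite eq_le; apply/andP; split.
  by apply: (@ell_infty_norm_le R (mk_ell_infty gp x)) => n; exact: gp.
apply/ler_addgt0Pr => e e0.
have je : 0 < `|j x| + e by rewrite ltr_wpDl.
apply/(body_gaugeP PB) => //; rewrite -(bipolar PB); apply/polarP => z zP.
rewrite dotZr ler_pdivrMl// mulr1 (@le_trans _ _ `|j x|) ?lerDl ?(ltW e0)//.
apply: le_of_mul_lt1 => // u u0 u1.
have [r r0 rP] := body_ball PB'.
apply/ler_addgt0Pr => s s0.
pose t := Num.min ((1 - u) * r) (s / (`|x| + 1)).
have x1 : 0 < `|x| + 1 by rewrite ltr_wpDl.
have u1' : 0 < 1 - u by rewrite subr_gt0.
have t0 : 0 < t by rewrite lt_min mulr_gt0//= divr_gt0.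
have [k] := dP (u *: z) t t0; rewrite distrC => zk.
have dkP : polar P (d k).
  have -> : d k = u *: z + (1 - u) *: ((1 - u)^-1 *: (d k - u *: z)).
    by rewrite scalerA mulfV ?gt_eqF// scale1r addrC subrK.
  apply: body_convex => //; rewrite ?(ltW u0) ?(ltW u1)//.
  apply: rP; rewrite normrZ gtr0_norm ?invr_gt0// ler_pdivrMl//.
  by rewrite (le_trans zk)// /t ge_min lexx.
have yk : y k = d k by rewrite /y; case: asboolP.
have : `|dot x (d k) : R| <= `|j x| by rewrite -yk; exact: (ell_infty_ball (j x) k).
have : `|dot (d k - u *: z) x : R| <= s.
  rewrite (le_trans (dot_le _ _))// (@le_trans _ _ (t * (`|x| + 1)))//.
    by rewrite ler_pM// lerDl.
  by rewrite -ler_pdivlMr// /t ge_min lexx orbT.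
rewrite dotDl dotNl dotZl (dotC (d k)) !ler_norml; lra.
Qed.

End EllInftyFacts.

(** * The tensor product induced by bounded sequences *)

Section NormBodies.
Context {R : realType} {E : euclideanType R}.

(** A norm attains a positive minimum on the compact Euclidean sphere. *)
Lemma norm_lower_bound (p : E -> R) : seminorm p -> (forall x, p x = 0 -> x = 0) ->
  exists2 c : R, 0 < c & forall x, c * `|x| <= p x.
Proof.
move=> pS p0.
have [x0|/nonemptyPn S0] := pselect ([set x : E | `|x| = 1] !=set0); last first.
  exists 1 => // x; have [->|x0] := eqVneq x 0.
    by rewrite normr0 mulr0 (seminorm_ge0 pS).
  suff : [set x : E | `|x| = 1] (`|x|^-1 *: x) by rewrite S0.
  by rewrite /= normrZ gtr0_norm ?invr_gt0 ?normr_gt0// mulVf// normr_eq0.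
have Sc : compact [set x : E | `|x| = 1].
  apply: (@heine_borel _ _ _ 1) => [|x /= ->//].
  apply: (@preimage_closed _ _ (fun x : E => `|x| : R^o) [set 1]).
    by move=> x _; exact: norm_continuous.
  exact: closed_eq.
have pC : {within [set x : E | `|x| = 1], continuous p}.
  by apply: continuous_subspaceT; exact: seminorm_continuous.
have [x /set_mem /= x1 xmin] := compact_EVT_min x0 Sc pC.
have px : 0 < p x.
  rewrite lt_neqAle (seminorm_ge0 pS) andbT eq_sym; apply/eqP => /p0 x00.
  by move: x1; rewrite x00 normr0 => /esym/eqP; rewrite oner_eq0.
exists (p x) => // y; have [->|y0] := eqVneq y 0.
  by rewrite normr0 mulr0 (seminorm_ge0 pS).
have y0' : 0 < `|y| by rewrite normr_gt0.
have : p x <= p (`|y|^-1 *: y).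
  apply: xmin; rewrite inE/= normrZ gtr0_norm ?invr_gt0// mulVf//.
  by rewrite normr_eq0.
by rewrite pS.2 gtr0_norm ?invr_gt0// ler_pdivlMl// mulrC.
Qed.

Lemma norm_body (p : E -> R) : seminorm p -> (forall x, p x = 0 -> x = 0) ->
  sym_convex_body [set x | p x <= 1].
Proof.
by move=> pS p0; have [c c0 cp] := norm_lower_bound pS p0; exact: (seminorm_body pS c0).
Qed.

Lemma body_ballE (P : set E) : sym_convex_body P -> P = [set x | gauge P x <= 1].
Proof. by move=> PB; apply/seteqP; split=> x; rewrite /= (body_gauge1 PB). Qed.

End NormBodies.

(** Used for inclusions of subspaces, where it says that a section of a body by a
    subspace is a body. *)
Lemma preimage_body {R : realType} {E F : euclideanType R} (k : {linear F -> E})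
    (P : set E) : sym_convex_body P -> (forall x, k x = 0 -> x = 0) ->
  sym_convex_body (k @^-1` P).
Proof.
move=> PB k0; rewrite (body_ballE PB).
apply: (norm_body (p := gauge P \o k)).
  exact: (seminorm_comp (body_gauge_seminorm PB) k).
by move=> x /(body_gauge_eq0 PB) /k0.
Qed.

Lemma preimage_gauge {R : realType} {E F : euclideanType R} (k : {linear F -> E})
    (P : set E) : gauge (k @^-1` P) = gauge P \o k.
Proof.
by apply/funext => x; rewrite /gauge/=; congr inf; apply/seteqP; split=> r /=;
  rewrite linearZ.
Qed.

Lemma gauge_le {R : realType} {E F : euclideanType R} (T : {linear E -> F})
    (P : set E) (Q : set F) : sym_convex_body P -> sym_convex_body Q ->
  T @` P `<=` Q -> forall x, gauge Q (T x) <= gauge P x.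
Proof.
move=> PB QB TPQ x; apply/ler_addgt0Pr => e e0.
have ge : 0 < gauge P x + e by rewrite ltr_wpDl// gauge_ge0.
apply/(body_gaugeP QB) => //; rewrite -linearZ; apply: TPQ; exists ((gauge P x + e)^-1 *: x) => //.
by apply/(body_gaugeP PB) => //; rewrite lerDl ltW.
Qed.

Section EtensorFacts.
Context {R : realType} {l : nat} {E : 'I_l -> euclideanType R}.

Lemma dot_etensorE (z : etensor E) (y : forall i, E i) :
  dot z (tens y : etensor E) = z (dot_form y) :> R.
Proof. by []. Qed.

Lemma etensor_eq0 (z : etensor E) :
  (forall y, dot z (tens y : etensor E) = 0 :> R) -> z = 0.
Proof.
move=> z0; apply: tensor_ext => f; rewrite etensor_expand big1// => a _.
by rewrite -dot_etensorE z0 mul0r.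
Qed.

(** A linear functional is bounded on a convex hull as on the generators. *)
Lemma polar_pi_prod (P : forall i, set (E i)) (z : etensor E) :
  polar (pi_prod P) z <->
  forall x : forall i, E i, (forall i, P i (x i)) -> dot (tens x : etensor E) z <= 1 :> R.
Proof.
split=> [/polarP zP x xP|zP].
  by apply: zP => C [_]; apply; exists x.
apply/polarP; apply: smallest_sub => [|_ [x xP <-]]; last exact: zP.
apply/convex_setE => x y t t0 t1 /= xz yz.
by rewrite dotDl !dotZl; nra.
Qed.

End EtensorFacts.

(** An explicit form of the injective hull of the projective tensor product. *)
Definition ell_infty_prod {R : realType} {l : nat} : @body_op R l := fun E P =>
  [set z | exists2 j : forall i, {linear E i -> ell_infty R},
    forall i, isometric_embedding (P i) (j i) &
    @projective_norm R l (fun=> ell_infty R) (tensor_map j z) <= 1].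

Section EllInftyProd.
Context {R : realType} {l : nat} (l_gt0 : (0 < l)%N).
Implicit Types E F : 'I_l -> euclideanType R.
Local Notation N := (@projective_norm R l (fun=> ell_infty R)).

Lemma body_embeddings E (P : forall i, set (E i)) : (forall i, sym_convex_body (P i)) ->
  exists j : forall i, {linear E i -> ell_infty R},
    forall i, isometric_embedding (P i) (j i).
Proof.
move=> PB; have jP i := cid (body_embedding (PB i)).
by exists (fun i => projT1 (jP i)) => i; exact: (projT2 (jP i)).
Qed.

(** A contraction between the embedded spaces extends to a contraction of l_oo, by
    injectivity, and contractions act as contractions on the projective norm. *)
Lemma projective_norm_mono E F (P : forall i, set (E i)) (Q : forall i, set (F i))
    (T : forall i, {linear E i -> F i})
    (j : forall i, {linear E i -> ell_infty R}) (k : forall i, {linear F i -> ell_infty R}) :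
  (forall i, sym_convex_body (P i)) -> (forall i, sym_convex_body (Q i)) ->
  (forall i, T i @` P i `<=` Q i) ->
  (forall i, isometric_embedding (P i) (j i)) ->
  (forall i, isometric_embedding (Q i) (k i)) ->
  forall z, N (tensor_map k (tensor_map T z)) <= N (tensor_map j z).
Proof.
move=> PB QB TPQ jP kQ z.
have /choice[S SP] i : exists S : {linear ell_infty R -> ell_infty R},
    (forall x, S (j i x) = (k i \o T i) x) /\ forall v, `|S v| <= `|v|.
  have [x|S S1 S2] := @ell_infty_extend R _ _ (j i) (k i \o T i : {linear _ -> _}).
    by rewrite jP /= kQ (gauge_le (PB i) (QB i)).
  by exists S.
pose kT i : {linear E i -> ell_infty R} := k i \o T i.
rewrite (tensor_map_comp (Q := kT))//.
rewrite -(tensor_map_comp (T := j) (S := S)); last by move=> i x; rewrite (SP i).1.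
by apply: projective_norm_map => // i x; exact: (SP i).2.
Qed.

Lemma ell_infty_prodE E (P : forall i, set (E i))
    (j : forall i, {linear E i -> ell_infty R}) :
  (forall i, sym_convex_body (P i)) -> (forall i, isometric_embedding (P i) (j i)) ->
  ell_infty_prod P = [set z | N (tensor_map j z) <= 1].
Proof.
move=> PB jP; apply/seteqP; split=> [z [k kP kz]|z jz]; last by exists j.
rewrite /= (le_trans _ kz)//.
pose T i : {linear E i -> E i} := idfun.
(* Two embeddings of the same body are compared through the identity map. *)
rewrite -[z in leLHS](tensor_map_id (T := T))//.
by apply: (projective_norm_mono PB PB) => // i _ [x Px <-].
Qed.

(** Extending the functionals [dot _ (y i)] to l_oo makes the product with an elementary
    tensor a product functional, which the projective norm controls. *)
Lemma projective_norm_ge_dot E (j : forall i, {linear E i -> ell_infty R})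
    (y : forall i, E i) (c : 'I_l -> R) z :
  (forall i, 0 < c i) -> (forall i x, `|dot x (y i) : R| <= c i * `|j i x|) ->
  `|dot z (tens y : etensor E) : R| <= (\prod_i c i) * N (tensor_map j z).
Proof.
move=> c0 yj.
have /choice[g gP] i : exists g : {scalar ell_infty R},
    (forall x, g (j i x) = dot x (y i)) /\ forall v, `|g v| <= `|c i *: v|.
  have [x|g g1 g2] := hahn_banach_norm (phi := j i) (f := dotr (y i)) (ltW (c0 i)).
    exact: yj.
  by exists g; split=> // v; rewrite normrZ gtr0_norm// g2.
have -> : dot z (tens y : etensor E) = (tensor_map j z) (prod_form g) :> R.
  rewrite dot_etensorE; change (z (dot_form y) = z (mform_comp j (prod_form g)) :> R).
  f_equal; apply: mform_ext => x /=; apply: eq_bigr => i _.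
  by rewrite (gP i).1.
apply: (projective_norm_max l_gt0 (p := fun u => `|u (prod_form g) : R|)).
- by split=> [u v|a u]; [exact: ler_normD|exact: normrM].
- by apply: prodr_ge0 => i _; exact: ltW.
move=> x; rewrite -big_split/= normr_prod.
apply: ler_prod => i _; rewrite normr_ge0 (le_trans ((gP i).2 _))//.
by rewrite normrZ gtr0_norm.
Qed.

Lemma projective_norm_pullback_seminorm E (j : forall i, {linear E i -> ell_infty R}) :
  seminorm (fun z => N (tensor_map j z)).
Proof.
exact: (seminorm_comp (projective_norm_seminorm l_gt0) (tensor_map j)).
Qed.

Lemma ell_infty_prod_body E (P : forall i, set (E i)) :
  (forall i, sym_convex_body (P i)) -> sym_convex_body (ell_infty_prod P).
Proof.
move=> PB; have [j jP] := body_embeddings PB.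
rewrite (ell_infty_prodE PB jP).
apply: norm_body; first exact: projective_norm_pullback_seminorm.
move=> z z0; apply: etensor_eq0 => y.
have /choice[c cP] i : exists c : R, 0 < c /\
    forall x, `|dot x (y i) : R| <= c * `|j i x|.
  have [c c0 cP] := body_gauge_lb (PB i).
  exists ((`|y i| + 1) / c); split=> [|x]; first by rewrite divr_gt0// ltr_wpDl.
  rewrite mulrAC ler_pdivlMr// (le_trans (ler_wpM2r (ltW c0) (dot_le _ _)))//.
  rewrite mulrAC mulrC ler_pM ?mulr_ge0 ?(ltW c0)// ?lerDl// mulrC.
  by rewrite (jP i x).
have := projective_norm_ge_dot z (fun i => (cP i).1) (fun i => (cP i).2).
by rewrite z0 mulr0 normr_le0 => /eqP.
Qed.

Lemma pi_prod_sub_ell_infty_prod E (P : forall i, set (E i)) :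
  (forall i, sym_convex_body (P i)) -> pi_prod P `<=` ell_infty_prod P.
Proof.
move=> PB; have [j jP] := body_embeddings PB.
rewrite (ell_infty_prodE PB jP); apply: smallest_sub.
  by apply: seminorm_convex; exact: projective_norm_pullback_seminorm.
move=> _ [x xP <-] /=; rewrite tensor_map_tens (le_trans (projective_norm_tens _))//.
by apply: prodr_ile1 => i _; rewrite normr_ge0 jP; exact/(body_gauge1 (PB i)).
Qed.

Lemma ell_infty_prod_sub_eps_prod E (P : forall i, set (E i)) :
  (forall i, sym_convex_body (P i)) -> ell_infty_prod P `<=` eps_prod P.
Proof.
move=> PB; have [j jP] := body_embeddings PB.
rewrite (ell_infty_prodE PB jP) => z /= jz; apply/polar_pi_prod => y yP.
have yj i x : `|dot x (y i) : R| <= 1 * `|j i x|.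
  by rewrite mul1r jP; exact: polar_gauge_norm.
have := projective_norm_ge_dot z (fun=> ltr01) yj.
by rewrite big1// mul1r ler_norml dotC => /andP[_ /le_trans]; apply.
Qed.

Lemma ell_infty_prod_tensor_product : tensor_product (@ell_infty_prod R l).
Proof.
split=> [E P PB|E P PB|E F P Q T PB QB TPQ]; first exact: ell_infty_prod_body.
  split; first exact: pi_prod_sub_ell_infty_prod.
  exact: ell_infty_prod_sub_eps_prod.
have [j jP] := body_embeddings PB; have [k kQ] := body_embeddings QB.
rewrite (ell_infty_prodE PB jP) (ell_infty_prodE QB kQ) => _ [z jz <-] /=.
by rewrite (le_trans _ jz)//; exact: (projective_norm_mono PB QB).
Qed.

(** The restriction to a subspace of an embedding is an embedding of the section. *)
Lemma ell_infty_prod_injective : injective_op (@ell_infty_prod R l).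
Proof.
move=> E P M PB; cbv zeta; have [j jP] := body_embeddings PB.
pose incl i : {linear subvs_of (M i) -> E i} := vsval.
have PMB i : sym_convex_body (vsval @^-1` P i : set (subvs_of (M i))).
  by apply: (preimage_body (k := incl i)) => // x x0; exact/val_inj.
pose k i : {linear subvs_of (M i) -> ell_infty R} := j i \o incl i.
have kP i : isometric_embedding (vsval @^-1` P i : set (subvs_of (M i))) (k i).
  by move=> x; rewrite /= jP (preimage_gauge (incl i)).
have kE w : tensor_map j (tensor_map incl w) = tensor_map k w.
  exact: tensor_map_comp.
rewrite (ell_infty_prodE PB jP) (ell_infty_prodE PMB kP).
apply/seteqP; split=> [_ [w kw <-]|z [jz [w _ wz]]].
  by split; [rewrite /= kE|exists w].
by exists w => //=; rewrite -kE wz.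
Qed.

End EllInftyProd.

(** * Finite-dimensional subspaces of bounded sequences *)

(** An alias, since matrices carry the maximum norm already. *)
Definition euc (R : realType) (m : nat) : Type := 'rV[R]_m.

Section Euc.
Context (R : realType) (m : nat).
HB.instance Definition _ := Vector.on (euc R m).

Definition euc_dot (u v : euc R m) : R := \sum_i u 0 i * v 0 i.

Fact euc_dotC u v : euc_dot u v = euc_dot v u.
Proof. by apply: eq_bigr => i _; rewrite mulrC. Qed.

Fact euc_dotPl y a u v : euc_dot (a *: u + v) y = a * euc_dot u y + euc_dot v y.
Proof.
rewrite /euc_dot mulr_sumr -big_split; apply: eq_bigr => i _ /=.
by rewrite !mxE mulrDl mulrA.
Qed.

Fact euc_dot_gt0 u : u != 0 -> 0 < euc_dot u u.
Proof.
move=> u0; rewrite lt_neqAle eq_sym; apply/andP; split; last first.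
  by apply: sumr_ge0 => i _; rewrite -expr2 sqr_ge0.
apply: contra u0; rewrite psumr_eq0; last by move=> i _; rewrite -expr2 sqr_ge0.
move=> /allP u0; apply/eqP/rowP => i; rewrite mxE.
by have /eqP/eqP := u0 i (mem_index_enum i); rewrite mulf_eq0 orbb => /eqP.
Qed.

HB.instance Definition _ :=
  Vector_isEuclidean.Build R (euc R m) euc_dotC euc_dotPl euc_dot_gt0.
End Euc.

Section FiniteDimension.
Context {R : realType}.

(** A coordinate system for the span of finitely many vectors: vectors are added only
    when they are independent of the previous ones. *)
Lemma finite_span (X : lmodType R) (s : seq X) : exists m (phi : {linear euc R m -> X}),
  (forall v, phi v = 0 -> v = 0) /\ forall x, x \in s -> exists v, phi v = x.
Proof.
elim: s => [|x s [m [phi [phi0 phis]]]].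
  have zP : linear (fun _ : euc R 0 => 0 : X) by move=> a u v; rewrite scaler0 addr0.
  exists 0%N, (mk_linear zP); split=> // v _; apply/rowP; by case.
have [[w wx]|nx] := pselect (exists w, phi w = x).
  exists m, phi; split=> // y; rewrite in_cons => /predU1P[->|/phis//].
  by exists w.
pose psi (v : euc R (m + 1)) : X :=
  phi (lsubmx (v : 'rV_(m + 1)) : euc R m) + (rsubmx (v : 'rV_(m + 1)) 0 0) *: x.
have psiP : linear psi.
  move=> a u v; rewrite /psi scalerDr scalerA addrACA; congr (_ + _).
    by rewrite -linearP; congr (phi _); apply/rowP => i; rewrite !mxE.
  by rewrite -scalerDl !mxE.
exists (m + 1)%N, (mk_linear psiP); split=> [v|y].
  rewrite /= /psi => v0.
  have c0 : rsubmx (v : 'rV_(m + 1)) 0 0 = 0.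
    apply/eqP; apply: contrapT => /negP c0; apply: nx.
    exists (- (rsubmx (v : 'rV_(m + 1)) 0 0)^-1 *: (lsubmx (v : 'rV_(m + 1)) : euc R m)).
    rewrite linearZ /=; move/eqP: v0; rewrite addr_eq0 => /eqP ->.
    by rewrite scalerN scaleNr opprK scalerA mulVf ?scale1r.
  move: v0; rewrite c0 scale0r addr0 => /phi0 l0.
  rewrite -[v]hsubmxK l0 (_ : rsubmx _ = 0) ?row_mx0//.
  by apply/rowP => i; rewrite (ord1 i) c0 mxE.
rewrite in_cons => /predU1P[->|/phis[w <-]].
  exists (row_mx 0 1%:M : 'rV_(m + 1)).
  by rewrite /= /psi row_mxKl row_mxKr linear0 add0r mxE eqxx scale1r.
exists (row_mx (w : 'rV_m) 0 : 'rV_(m + 1)).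
by rewrite /= /psi row_mxKl row_mxKr mxE scale0r addr0.
Qed.

Lemma linear_factor (E F X : lmodType R) (phi : {linear F -> X}) (T : {linear E -> X}) :
  (forall v, phi v = 0 -> v = 0) -> (forall x, exists v, phi v = T x) ->
  exists k : {linear E -> F}, forall x, phi (k x) = T x.
Proof.
move=> phi0 /choice[k kP].
have kL : linear k.
  move=> a u v; apply/eqP; rewrite -subr_eq0; apply/eqP/phi0.
  by rewrite linearB linearP !kP linearP subrr.
by exists (mk_linear kL).
Qed.

(** Coordinate functionals of [F] are bounded for the norm of [V], so they extend.
    Tensor products of maps with left inverses are injective. *)
Lemma linear_left_inverse (F : euclideanType R) (V : normedModType R)
    (phi : {linear F -> V}) : (forall v, phi v = 0 -> v = 0) ->
  exists chi : {linear V -> F}, forall v, chi (phi v) = v.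
Proof.
move=> phi0; have [n [e [eo eE]]] := orthonormal_basis F.
have pS : seminorm (fun v => `|phi v|) by exact: (seminorm_comp normr_seminorm phi).
have [v /eqP|c c0 cP] := norm_lower_bound pS.
  by rewrite normr_eq0 => /eqP /phi0.
have /choice[g gP] i : exists g : {scalar V}, forall v, g (phi v) = dot v (e i).
  have [||g g1 _] := hahn_banach_norm (phi := phi) (f := dotr (e i)) (c := `|e i| / c).
  - by rewrite divr_ge0// ltW.
  - move=> v; rewrite (le_trans (dot_le _ _))// mulrAC ler_pdivlMr// mulrAC.
    by rewrite [leRHS]mulrC ler_wpM2r// mulrC.
  - by exists g.
have chiP : linear (fun v => \sum_i g i v *: e i).
  move=> a u v; rewrite scaler_sumr -big_split/=; apply: eq_bigr => i _.
  by rewrite linearP scalerDl scalerA.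
exists (mk_linear chiP) => v /=; rewrite [RHS]eE.
by apply: eq_bigr => i _; rewrite gP.
Qed.

End FiniteDimension.

Section GaugeTens.
Context {R : realType} {l : nat}.

Lemma tens_scale {V : 'I_l -> lmodType R} (a : 'I_l -> R) (x : forall i, V i) :
  tens (fun i => a i *: x i) = (\prod_i a i) *: tens x.
Proof.
suff H (s : seq 'I_l) : uniq s ->
    tens (fun i => (if i \in s then a i else 1) *: x i) = (\prod_(i <- s) a i) *: tens x.
  rewrite -[RHS]H ?index_enum_uniq//; congr tens.
  by apply: functional_extensionality_dep => i; rewrite mem_index_enum.
elim: s => [_|i s IH /= /andP[si us]].
  rewrite big_nil scale1r; congr tens.
  by apply: functional_extensionality_dep => i; rewrite scale1r.
rewrite big_cons -scalerA -IH// (tensZ _ i); congr tens.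
apply: functional_extensionality_dep => k; rewrite in_cons.
have [<-|ik] := eqVneq i k; first by rewrite dfwith_in (negbTE si) /= scale1r.
by rewrite dfwith_out.
Qed.

(** Normalising every factor puts the elementary tensor into the projective product. *)
Lemma gauge_tens (E : 'I_l -> euclideanType R) (P : forall i, set (E i)) (K : set (etensor E))
    (x : forall i, E i) :
  (forall i, sym_convex_body (P i)) -> sym_convex_body K -> pi_prod P `<=` K ->
  gauge K (tens x : etensor E) <= \prod_i gauge (P i) (x i).
Proof.
move=> PB KB piK.
have [[i /(body_gauge_eq0 (PB i)) xi]|gx] := pselect (exists i, gauge (P i) (x i) = 0).
  rewrite (tens_eq0 (V := fun i => E i : lmodType R) xi) (seminorm0 (body_gauge_seminorm KB)).
  by apply: prodr_ge0 => k _; exact: gauge_ge0.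
have g0 i : 0 < gauge (P i) (x i).
  rewrite lt_neqAle gauge_ge0// andbT eq_sym; apply/eqP => xi; apply: gx.
  by exists i.
apply/(body_gaugeP KB); first by rewrite prodr_gt0.
rewrite -prodfV -tens_scale; apply: piK => C [_]; apply.
exists (fun i => (gauge (P i) (x i))^-1 *: x i) => // i.
exact/(body_gaugeP (PB i)).
Qed.

End GaugeTens.

(** * The injective hull of the projective product *)

Section InjectiveHull.
Context {R : realType} {l : nat} (l_gt0 : (0 < l)%N).
Context (E : 'I_l -> euclideanType R) (P : forall i, set (E i)).
Arguments P : clear implicits.
Hypothesis PB : forall i, sym_convex_body (P i).
Context (j : forall i, {linear E i -> ell_infty R}).
Arguments j : clear implicits.
Hypothesis jP : forall i, isometric_embedding (P i) (j i).
Local Notation N := (@projective_norm R l (fun=> ell_infty R)).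

(** Combines injectivity on the range of [k], where the two products agree, with
    uniformity for the inverse of [k] on its range. *)
Lemma injective_op_reflect (b : @body_op R l) (F : 'I_l -> euclideanType R)
    (Q : forall i, set (F i)) (k : forall i, {linear E i -> F i}) :
  tensor_product b -> injective_op b -> (forall i, sym_convex_body (Q i)) ->
  (forall i, k i @^-1` Q i = P i) ->
  forall z, b F Q (tensor_map k z) -> b E P z.
Proof.
move=> bT bI QB kQP z bz.
have k0 i x : k i x = 0 -> x = 0.
  move=> kx; apply: (body_gauge_eq0 (PB i)).
  by rewrite -kQP preimage_gauge /= kx (seminorm0 (body_gauge_seminorm (QB i))).
have kinj i : lker (linfun (k i)) == 0%VS.
  by apply/lker0P => x y; rewrite !lfunE /= => xy; apply/eqP; rewrite -subr_eq0;
    apply/eqP/k0; rewrite linearB /= xy subrr.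
pose M i : {vspace F i} := limg (linfun (k i)).
pose incl i : {linear subvs_of (M i) -> F i} := vsval.
pose k' i : {linear E i -> subvs_of (M i)} := vsproj (M i) \o k i.
pose T i : {linear F i -> E i} := (linfun (k i))^-1%VF.
pose S i : {linear subvs_of (M i) -> E i} := T i \o incl i.
have Tk i x : T i (k i x) = x by rewrite -[k i x]lfunE; exact: lker0_lfunK.
have QMB i : sym_convex_body (vsval @^-1` Q i : set (subvs_of (M i))).
  by apply: (preimage_body (k := incl i)) => // x x0; exact/val_inj.
have [w bw wz] : (tensor_map incl @` b _ (fun i => vsval @^-1` Q i)) (tensor_map k z).
  rewrite (bI F Q M QB); split=> //; exists (tensor_map k' z) => //.
  apply: tensor_map_comp => i x /=; rewrite vsprojK//.
  by rewrite -[k i x]lfunE memv_img// memvf.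
have <- : tensor_map S w = z.
  rewrite -(tensor_map_comp (T := incl) (S := T))// wz.
  pose idE i : {linear E i -> E i} := idfun.
  by rewrite (tensor_map_comp (Q := idE))// tensor_map_id.
apply: (tensor_product_uniform bT QMB PB) => [i|]; last by exists w.
move=> _ [m Qm <-]; rewrite -kQP /=.
have /memv_imgP[x _ mx] := subvsP m.
by rewrite /= mx lfunE /= Tk; move: Qm; rewrite /= mx lfunE.
Qed.

(** The lower half of the description of the hull: everything that a representation in
    l_oo uses already happens in finite-dimensional subspaces, on which [b] is defined. *)
Lemma gauge_le_projective_norm (b : @body_op R l) :
  tensor_product b -> injective_op b -> le_op (@pi_prod R l) b ->
  forall z, gauge (b E P) z <= N (tensor_map j z).
Proof.
move=> bT bI pib z; apply: (le_projective_norm l_gt0) => n x zx.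
(* The common space of j i (E i) and of the i-th factors of the representation. *)
have jX i : exists m (phi : {linear euc R m -> ell_infty R}),
    [/\ (forall v, phi v = 0 -> v = 0), (forall y, exists v, phi v = j i y) &
      forall k, exists v, phi v = x k i].
  have [d [e [_ eE]]] := orthonormal_basis (E i).
  have [m [phi [phi0 phis]]] := finite_span
    ([seq j i (e a) | a <- enum 'I_d] ++ [seq x k i | k <- enum 'I_n]).
  exists m, phi; split=> // [y|k]; last first.
    by apply: phis; rewrite mem_cat; apply/orP; right; apply/mapP; exists k; rewrite ?mem_enum.
  have /choice[v vP] a : exists v, phi v = j i (e a).
    by apply: phis; rewrite mem_cat; apply/orP; left; apply/mapP; exists a; rewrite ?mem_enum.
  exists (\sum_a (dot y (e a) : R) *: v a).
  rewrite linear_sum [in RHS](eE y) linear_sum; apply: eq_bigr => a _.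
  by rewrite !linearZ vP.
pose m i := projT1 (cid (jX i)); pose phiX i := cid (projT2 (cid (jX i))).
pose F i : euclideanType R := euc R (m i).
pose phi i : {linear F i -> ell_infty R} := projT1 (phiX i).
have phi0 i : forall v, phi i v = 0 -> v = 0.
  by have [h _ _] := projT2 (phiX i).
have phij i : forall y, exists v, phi i v = j i y.
  by have [_ h _] := projT2 (phiX i).
have phix i : forall k, exists v, phi i v = x k i.
  by have [_ _ h] := projT2 (phiX i).
have kX i := cid (linear_factor (phi0 i) (phij i)).
pose k i := projT1 (kX i); have kP i y : phi i (k i y) = j i y := projT2 (kX i) y.
pose y a i := projT1 (cid (phix i a)).
have yP a i : phi i (y a i) = x a i := projT2 (cid (phix i a)).
have chiX i := cid (linear_left_inverse (phi0 i)).
pose chi i := projT1 (chiX i); have chiP i v : chi i (phi i v) = v := projT2 (chiX i) v.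
pose p i (v : F i) := `|phi i v|.
have pS i : seminorm (p i) by exact: (seminorm_comp normr_seminorm (phi i)).
pose Q i : set (F i) := [set v | p i v <= 1].
have QB i : sym_convex_body (Q i).
  by apply: norm_body => // v /eqP; rewrite normr_eq0 => /eqP /phi0.
(* The representation lives in the tensor product of the F i already, because the
   tensor product of the phi i has a left inverse. *)
have kz : tensor_map k z = \sum_a tens (y a).
  pose idF i : {linear F i -> F i} := idfun.
  rewrite -[RHS](tensor_map_id (T := idF))// -(tensor_map_comp (T := phi) (S := chi))//.
  rewrite linear_sum/= (eq_bigr (fun a => tens (x a))); last first.
    move=> a _; rewrite tensor_map_tens; congr tens.
    by apply: functional_extensionality_dep => i; exact: yP.
  by rewrite -zx -(tensor_map_comp (T := k) (S := phi))// (tensor_map_comp (Q := idF))//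
    tensor_map_id.
have bPB := tensor_product_body bT PB; have bQB := tensor_product_body bT QB.
have kQP i : k i @^-1` Q i = P i.
  have kQ v : Q i (k i v) <-> P i v by rewrite (body_gauge1 (PB i)) -jP -kP.
  by apply/seteqP; split=> v /kQ.
apply: (@le_trans _ _ (gauge (b F Q) (tensor_map k z))).
  apply/ler_addgt0Pr => e e0.
  have ge : 0 < gauge (b F Q) (tensor_map k z) + e by rewrite ltr_wpDl// gauge_ge0.
  apply/(body_gaugeP bPB) => //; apply: (injective_op_reflect bT bI QB kQP).
  by rewrite linearZ; apply/(body_gaugeP bQB) => //; rewrite lerDl ltW.
rewrite kz (le_trans (seminorm_sum (body_gauge_seminorm bQB) _))//.
apply: ler_sum => a _.
rewrite (le_trans (gauge_tens _ QB bQB _))//; first exact: pib.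
by rewrite le_eqVlt; apply/orP; left; apply/eqP; apply: eq_bigr => i _;
  rewrite (seminorm_gauge (pS i)) /p yP.
Qed.

Theorem inj_op_pi_prod : inj_op (@pi_prod R l) P = [set z | N (tensor_map j z) <= 1].
Proof.
apply/seteqP; split=> [z zb|z jz b bT bI pib].
  rewrite -(ell_infty_prodE l_gt0 PB jP); apply: zb.
  - exact: (ell_infty_prod_tensor_product l_gt0).
  - exact: (ell_infty_prod_injective l_gt0).
  - by move=> F Q QB; exact: pi_prod_sub_ell_infty_prod.
apply/(body_gauge1 (tensor_product_body bT PB)).
by rewrite (le_trans _ jz)//; exact: gauge_le_projective_norm.
Qed.

End InjectiveHull.

(** * Summable sequences and adjoints of quotient maps *)

Section EllOneFacts.
Context {R : realType}.

Lemma unit_seq_sum n m : \sum_(0 <= k < m) `|(k == n)%:R : R| <= 1.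
Proof.
rewrite big_mkord; have [nm|nm] := ltnP n m.
  rewrite (bigD1 (Ordinal nm))//= eqxx normr1 big1 ?addr0// => k kn.
  by rewrite (_ : _ == _ = false) ?normr0//; apply/negbTE.
rewrite big1// => k _; rewrite (_ : _ == _ = false) ?normr0//.
by apply/negbTE; rewrite neq_ltn (leq_trans (ltn_ord k) nm).
Qed.

Lemma unit_seq_subproof n : (fun k => (k == n)%:R : R^o) \in @ell_one_pred R.
Proof.
apply/asboolP; apply: nondecreasing_is_cvgn.
  by apply: nondecreasing_series => k _ _; exact: normr_ge0.
by exists 1 => _ [m _ <-]; exact: unit_seq_sum.
Qed.

Definition unit_seq n : ell_one R := EllOne (unit_seq_subproof n).

Lemma unit_seq_norm n : `|unit_seq n| <= 1.
Proof. by apply: ell_one_norm_le => m; exact: unit_seq_sum. Qed.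

Lemma ell_one_addE (x y : ell_one R) n : (x + y) n = x n + y n :> R.
Proof. by []. Qed.

Lemma ell_one_scaleE a (x : ell_one R) n : (a *: x) n = a * x n :> R.
Proof. by []. Qed.

Lemma ell_one_sumE m (F : 'I_m -> ell_one R) n : (\sum_k F k) n = \sum_k F k n :> R.
Proof.
by elim/big_ind2 : _ => [//|u a v b ua vb|//]; rewrite -ua -vb.
Qed.

Definition ell_pair (x : ell_one R) (y : ell_infty R) : R :=
  limn (series (fun n => (x n : R) * y n)).

Lemma ell_pair_cvg (x : ell_one R) (y : ell_infty R) : cvgn (series (fun n => (x n : R) * y n)).
Proof.
apply: normed_cvg.
have le n : `|(x n : R) * y n| <= `|y| * `|x n : R|.
  by rewrite normrM mulrC; apply: ler_wpM2r => //; exact: ell_infty_ball.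
refine (series_le_cvg _ _ le _) => [n|n|]; [exact: normr_ge0|exact: mulr_ge0|].
exact: (is_cvg_seriesZ (k := `|y|) (ell_one_cvg (x := x))).
Qed.

Lemma ell_pair_linear (a : R) (x x' x'' : ell_one R) (y y' y'' : ell_infty R) :
  (forall n, (x'' n : R) * y'' n = a * ((x n : R) * y n) + (x' n : R) * y' n) ->
  ell_pair x'' y'' = a * ell_pair x y + ell_pair x' y'.
Proof.
move=> xyE; apply: cvg_lim => //.
rewrite (_ : series _ = (fun n => a * series (fun n => (x n : R) * y n) n +
  series (fun n => (x' n : R) * y' n) n)); last first.
  apply/funext => n; rewrite /series/= mulr_sumr -big_split/=.
  by apply: eq_bigr => k _.
by apply: cvgD; [apply: cvgM; [exact: cvg_cst|]|]; exact: ell_pair_cvg.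
Qed.

Lemma ell_pairDl a x x' y : ell_pair (a *: x + x') y = a * ell_pair x y + ell_pair x' y.
Proof.
by apply: ell_pair_linear => n; rewrite ell_one_addE ell_one_scaleE mulrDl mulrA.
Qed.

Lemma ell_pairDr a x y y' : ell_pair x (a *: y + y') = a * ell_pair x y + ell_pair x y'.
Proof.
apply: ell_pair_linear => n.
have -> : (a *: y + y') n = a * y n + y' n :> R by [].
by rewrite mulrDr mulrCA.
Qed.

Lemma ell_pair_le x y : `|ell_pair x y| <= `|x| * `|y|.
Proof.
have le n : `|series (fun n => (x n : R) * y n) n| <= `|x| * `|y|.
  rewrite (le_trans (ler_norm_sum _ _ _))//.
  rewrite (le_trans _ (ler_wpM2r _ (ell_one_norm_ub x n)))// mulr_suml.
  apply: ler_sum => k _; rewrite normrM; apply: ler_wpM2l => //.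
  exact: ell_infty_ball.
rewrite ler_norml; apply/andP; split.
  apply: limr_ge; first exact: ell_pair_cvg.
  by apply: nearW => n; have := le n; rewrite ler_norml => /andP[].
apply: limr_le; first exact: ell_pair_cvg.
by apply: nearW => n; have := le n; rewrite ler_norml => /andP[].
Qed.

Lemma ell_one_tail (x : ell_one R) n :
  `|x - \sum_(k < n) (x k : R) *: unit_seq k| <= `|x| - \sum_(0 <= k < n) `|x k : R|.
Proof.
have tE m : (x - \sum_(k < n) (x k : R) *: unit_seq k) m =
    (if (m < n)%N then 0 else x m) :> R.
  have -> : (x - \sum_(k < n) (x k : R) *: unit_seq k) m =
      x m - \sum_(k < n) (x k : R) * (m == k)%:R :> R.
    by rewrite -[LHS]/(x m - (\sum_(k < n) (x k : R) *: unit_seq k) m) ell_one_sumE.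
  have [mn|nm] := ltnP m n.
    rewrite (bigD1 (Ordinal mn))//= eqxx mulr1 big1 ?addr0 ?subrr// => k km.
    by rewrite eq_sym (_ : _ == _ = false) ?mulr0//; apply/negbTE.
  rewrite big1 ?subr0// => k _; rewrite (_ : _ == _ = false) ?mulr0//.
  by apply/negbTE; rewrite neq_ltn (leq_trans (ltn_ord k) nm) orbT.
apply: ell_one_norm_le => m; rewrite lerBrDr.
have nM : (n <= maxn m n)%N by exact: leq_maxr.
apply: le_trans (ell_one_norm_ub x (maxn m n)).
rewrite [leRHS](big_cat_nat (n := n))// [leRHS]addrC lerD2r.
rewrite [leLHS](eq_bigr (fun k => if (k < n)%N then 0 else `|x k : R|)); last first.
  by move=> k _; rewrite tE; case: ifP => // _; rewrite normr0.
apply: (@le_trans _ _ (\sum_(0 <= k < maxn m n) (if (k < n)%N then 0 else `|x k : R|))).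
  rewrite [leRHS](big_cat_nat (n := m)) ?leq_maxl//= lerDl.
  by apply: sumr_ge0 => k _; case: ifP.
rewrite [leLHS](big_cat_nat (n := n))//=.
rewrite [X in X + _]big_nat_cond [X in X + _]big1 ?add0r; last first.
  by move=> k /andP[/andP[_ ->]].
rewrite le_eqVlt; apply/orP; left; apply/eqP.
by apply: eq_big_nat => k /andP[nk _]; rewrite ltnNge nk.
Qed.

Lemma ell_one_approx (x : ell_one R) (e : R) : 0 < e ->
  exists n, `|x - \sum_(k < n) (x k : R) *: unit_seq k| <= e.
Proof.
move=> e0.
have /cvgrPdist_le /(_ e e0) [n _ /(_ n (leqnn n)) h] :
    series (fun n => `|x n : R|) n @[n --> \oo] --> (`|x| : R) by exact: ell_one_cvg.
exists n; rewrite (le_trans (ell_one_tail _ _))//.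
by move: h; rewrite /= ler_norml => /andP[].
Qed.

Lemma ell_pair_unit y n : ell_pair (unit_seq n) y = y n.
Proof.
apply: lim_near_cst => //; near=> m.
have nm : (n < m)%N by near: m; exact: nbhs_infty_gt.
rewrite /series/= big_mkord (bigD1 (Ordinal nm))//= eqxx mul1r big1 ?addr0// => k kn.
by rewrite (_ : _ == _ = false) ?mul0r//; apply/negbTE.
Unshelve. all: by end_near. Qed.

Lemma ell_pairl_scalar y : scalar (ell_pair ^~ y).
Proof. by move=> a x x'; exact: ell_pairDl. Qed.

Lemma ell_pairr_scalar x : scalar (ell_pair x).
Proof. by move=> a y y'; exact: ell_pairDr. Qed.

Definition ell_pairl y : {scalar ell_one R} := mk_scalar (ell_pairl_scalar y).
Definition ell_pairr x : {scalar ell_infty R} := mk_scalar (ell_pairr_scalar x).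

(** Both sides are continuous, and the finitely supported sequences are dense in l_1. *)
Lemma ell_one_dual (h : {scalar ell_one R}) (c : R) (y : ell_infty R) :
  (forall x, `|h x| <= c * `|x|) -> (forall n, h (unit_seq n) = y n) ->
  forall x, h x = ell_pair x y.
Proof.
move=> hc hy x; apply/eqP; rewrite -subr_eq0 -normr_le0.
apply/ler_addgt0Pr => e e0; rewrite add0r.
have c0 : 0 <= `|c| + `|y| + 1 by rewrite !addr_ge0.
have e0' : 0 < e / (`|c| + `|y| + 1) by rewrite divr_gt0// ltr_wpDl ?addr_ge0.
have [n] := ell_one_approx x e0'; set t := \sum_(k < n) _ => xt.
have -> : h x - ell_pair x y = h (x - t) - ell_pairl y (x - t).
  have ht : h t = ell_pairl y t.
    rewrite /t !linear_sum; apply: eq_bigr => k _.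
    by rewrite !linearZ hy /= ell_pair_unit.
  have -> : h (x - t) = h x - h t by rewrite linearB.
  have -> : ell_pairl y (x - t) = ell_pair x y - h t by rewrite linearB -ht.
  by rewrite opprB addrA subrK.
rewrite (le_trans (ler_normB _ _))// (@le_trans _ _ ((`|c| + `|y| + 1) * `|x - t|))//.
  rewrite -addrA mulrDl lerD//.
    by rewrite (le_trans (hc _))// ler_wpM2r// ler_norm.
  rewrite mulrDl ler_wpDr// mulrC; exact: ell_pair_le.
by rewrite mulrC -ler_pdivlMr// ltr_wpDl ?addr_ge0.
Qed.

Section Quotient.
Context {E : euclideanType R} (P : set E) (q : {linear ell_one R -> E}).
Hypotheses (PB : sym_convex_body P) (qP : quotient_mapping P q).

Lemma quotient_gauge_le x : gauge P (q x) <= `|x|.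
Proof.
apply/ler_addgt0Pr => e e0; have xe : 0 < `|x| + e by rewrite ltr_wpDl.
have : (q @` [set x | `|x| < 1]) (q ((`|x| + e)^-1 *: x)).
  exists ((`|x| + e)^-1 *: x) => //=.
  by rewrite normrZ gtr0_norm ?invr_gt0// ltr_pdivrMl// mulr1 ltrDl.
rewrite qP.2 /= linearZ (body_gauge_seminorm PB).2 gtr0_norm ?invr_gt0//.
by rewrite ltr_pdivrMl// mulr1 => /ltW.
Qed.

Lemma quotient_surj y : exists x, q x = y.
Proof.
have gy : 0 < gauge P y + 1 by rewrite ltr_wpDl// gauge_ge0.
have : [set y | gauge P y < 1] ((gauge P y + 1)^-1 *: y).
  rewrite /= (body_gauge_seminorm PB).2 gtr0_norm ?invr_gt0//.
  by rewrite ltr_pdivrMl// mulr1 ltrDl.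
rewrite -qP.2 => -[x _ xy]; exists ((gauge P y + 1) *: x).
by rewrite linearZ /= xy scalerA mulfV ?gt_eqF// scale1r.
Qed.

(** The adjoint of [q]: its coordinates are the functionals [dot (q e_n)], and duality
    turns the quotient property into isometry for the polar gauge. *)
Lemma quotient_adjoint : exists j : {linear E -> ell_infty R},
  isometric_embedding (polar P) j /\ forall x y, dot (q x) y = ell_pair x (j y) :> R.
Proof.
have PB' := polar_body PB.
have gp n y : `|dotr (q (unit_seq n)) y| <= gauge (polar P) y.
  apply: (polar_gauge_norm PB'); rewrite (bipolar PB); apply/(body_gauge1 PB).
  exact: (le_trans (quotient_gauge_le _) (unit_seq_norm n)).
pose j := mk_linear (mk_ell_infty_linear (g := fun n => dotr (q (unit_seq n)) : {scalar E}) gp).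
have [c c0 cP] := body_gauge_lb PB.
have jq x y : dot (q x) y = ell_pair x (j y) :> R.
  have hP : scalar (fun x => dot (q x) y) by move=> a u v; rewrite linearP dotPl.
  apply: (@ell_one_dual (mk_scalar hP) (`|y| / c)) => [{}x|n] /=; last exact: dotC.
  rewrite (le_trans (dot_le _ _))// mulrC -mulrA ler_wpM2l// ler_pdivlMl//.
  exact: le_trans (cP _) (quotient_gauge_le _).
exists j; split=> // y; apply/eqP; rewrite eq_le; apply/andP; split.
  by apply: (@ell_infty_norm_le R (mk_ell_infty gp y)) => n; exact: gp.
apply/ler_addgt0Pr => e e0.
have je : 0 < `|j y| + e by rewrite ltr_wpDl.
apply/(body_gaugeP PB') => //; apply/polarP => x /(body_gauge1 PB) x1.
rewrite dotZr ler_pdivrMl// mulr1 (@le_trans _ _ `|j y|) ?lerDl ?(ltW e0)//.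
apply: le_of_mul_lt1 => // u u0 u1.
have : [set y | gauge P y < 1] (u *: x).
  rewrite /= (body_gauge_seminorm PB).2 gtr0_norm//.
  by rewrite (le_lt_trans _ u1)// ger_pMr.
rewrite -qP.2 => -[v /= v1 vx]; rewrite -dotZl -vx jq.
rewrite (le_trans (ler_norm _))// (le_trans (ell_pair_le _ _))//.
by rewrite ler_piMl// ltW.
Qed.

End Quotient.

End EllOneFacts.

(** * The injective norm *)

Section InjectiveNorm.
Context {R : realType} {l : nat} {X : 'I_l -> normedModType R}.
Let XX := tensor (fun i => X i : lmodType R).

Lemma prod_form0 (f : forall i, {scalar X i}) i (u : XX) :
  (forall x, f i x = 0) -> u (prod_form f) = 0 :> R.
Proof.
move=> fi0; have [n [c [x ux]]] := tensor_eval u.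
by rewrite ux big1// => k _; rewrite /= (bigD1 i)//= fi0 mul0r mulr0.
Qed.

Lemma injective_norm_ge (u : XX) (f : forall i, {scalar X i}) :
  (forall i x, `|f i x| <= `|x|) -> `|u (prod_form f) : R| <= injective_norm u.
Proof.
move=> fX; apply: ub_le_sup; last by exists f.
have [n [c [x ux]]] := tensor_eval u.
exists (\sum_(k < n) `|c k| * \prod_i `|x k i|) => _ [g gX ->].
rewrite ux (le_trans (ler_norm_sum _ _ _))//; apply: ler_sum => k _.
rewrite normrM; apply: ler_wpM2l => //; rewrite /= normr_prod.
by apply: ler_prod => i _; rewrite normr_ge0 gX.
Qed.

Lemma injective_norm_le (u : XX) (m : R) : (forall f : forall i, {scalar X i},
    (forall i x, `|f i x| <= `|x|) -> `|u (prod_form f) : R| <= m) ->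
  injective_norm u <= m.
Proof.
move=> um; apply: ge_sup => [|_ [f fX ->]]; last exact: um.
pose f0 i : {scalar X i} := \0.
exists `|u (prod_form f0) : R|, f0 => // i x; by rewrite normr0.
Qed.

Lemma injective_norm_form (u : XX) (f : forall i, {scalar X i}) (c : 'I_l -> R) :
  (forall i, 0 <= c i) -> (forall i x, `|f i x| <= c i * `|x|) ->
  `|u (prod_form f) : R| <= injective_norm u * \prod_i c i.
Proof.
move=> c0 fX.
have [[i ci]|cn] := pselect (exists i, c i = 0).
  rewrite (prod_form0 (i := i)) => [|x].
    by rewrite normr0 (bigD1 i)//= ci mul0r mulr0.
  by apply/eqP; rewrite -normr_le0 (le_trans (fX i x))// ci mul0r.
have cp i : 0 < c i.
  by rewrite lt_neqAle c0 andbT eq_sym; apply/eqP => ci; apply: cn; exists i.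
have gP i : scalar (fun x => (c i)^-1 * f i x).
  by move=> a x y; rewrite linearP mulrDr mulrCA.
pose g i := mk_scalar (gP i).
have -> : u (prod_form f) = (\prod_i c i) * u (prod_form g) :> R.
  have [n [d [x ux]]] := tensor_eval u.
  rewrite !ux mulr_sumr; apply: eq_bigr => k _; rewrite mulrCA /= -big_split/=.
  by congr (_ * _); apply: eq_bigr => i _; rewrite mulVKf// gt_eqF.
have C0 : 0 <= \prod_i c i by apply: prodr_ge0.
rewrite normrM (ger0_norm C0) mulrC; apply: ler_wpM2r => //.
apply: injective_norm_ge => i x /=.
by rewrite normrM gtr0_norm ?invr_gt0// ler_pdivrMl.
Qed.

End InjectiveNorm.

(** * Duality between the injective and the projective norm *)

Section Nets.
Context {R : realType}.

(** Sequences with the same integer part after division by [e] differ by at most [e];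
    boundedness leaves finitely many integer parts. *)
Lemma ell_infty_net (s : seq (ell_infty R)) (e : R) : 0 < e ->
  exists (T : finType) (c : nat -> T), forall y, y \in s ->
    forall m m', c m = c m' -> `|y m - y m' : R| <= e.
Proof.
move=> e0; elim: s => [|y s [T [c cP]]].
  by exists unit, (fun=> tt).
pose t m : nat := Num.truncn ((`|y| + y m) / e).
have y0 m : 0 <= `|y| + y m.
  by have := ell_infty_ball y m; rewrite ler_norml; lra.
have tK m : (t m < (Num.truncn ((`|y| + `|y|) / e)).+1)%N.
  rewrite ltnS; apply: le_truncn; rewrite ler_pM2r ?invr_gt0// lerD2l.
  by rewrite (le_trans (ler_norm _))// ell_infty_ball.
exists (T * 'I_(Num.truncn ((`|y| + `|y|) / e)).+1)%type.
exists (fun m => (c m, Ordinal (tK m))) => z; rewrite in_cons => /predU1P[->|zs] m m' [cc tt].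
  have tm k : (t k)%:R * e <= `|y| + y k < (t k)%:R * e + e.
    have /andP[t1 t2] := truncn_itv (divr_ge0 (y0 k) (ltW e0)).
    move: t1 t2; rewrite ler_pdivlMr// ltr_pdivrMr// -natr1 [X in _ < X]mulrDl mul1r.
    by move=> -> ->.
  have /andP[] := tm m; have /andP[] := tm m'; rewrite tt ler_norml; lra.
exact: (cP z zs).
Qed.

Lemma ell_infty_finite_net (s : seq (ell_infty R)) (e : R) : 0 < e ->
  exists n (r : 'I_n -> nat) (c : nat -> 'I_n),
    forall y, y \in s -> forall m, `|y m - y (r (c m)) : R| <= e.
Proof.
move=> e0; have [T [c cP]] := ell_infty_net s e0.
(* r chooses an index in every block that c meets. *)
have rP (a : 'I_#|T|) : exists m, (exists m', enum_rank (c m') = a) -> enum_rank (c m) = a.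
  by have [[m ma]|na] := pselect (exists m', enum_rank (c m') = a); [exists m|exists 0%N].
have [r rE] := choice rP.
exists #|T|, r, (fun m => enum_rank (c m)) => y ys m.
apply: (cP y ys); apply: enum_rank_inj; symmetry; apply: rE; by exists m.
Qed.

End Nets.

(** Factors are exchanged one at a time, each exchange costing one factor [e]. *)
Lemma tens_close {R : realType} {l : nat} {X : 'I_l -> normedModType R} (l_gt0 : (0 < l)%N)
    (y y' : forall i, X i) (M e : R) :
  1 <= M -> 0 <= e -> (forall i, `|y i| <= M) -> (forall i, `|y' i| <= M) ->
  (forall i, `|y i - y' i| <= e) ->
  @projective_norm R l X (tens y - tens y') <= l%:R * (e * M ^+ l).
Proof.
move=> M1 e0 yM yM' yy.
have M0 : 0 <= M by rewrite (le_trans ler01).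
have NS := projective_norm_seminorm l_gt0 (X := X).
(* The factors with index in s have been exchanged. *)
pose h (s : seq 'I_l) : forall i, X i := fun i => if i \in s then y' i else y i.
have H (s : seq 'I_l) : uniq s ->
    projective_norm (tens y - tens (h s) : tensor (fun i => X i : lmodType R)) <=
      (size s)%:R * (e * M ^+ l).
  elim: s => [_|i s IH /= /andP[si us]].
    have -> : h [::] = y by apply: functional_extensionality_dep => i.
    by rewrite subrr (seminorm0 NS) mul0r.
  have hi : h (i :: s) = dfwith (h s) (y' i).
    apply: functional_extensionality_dep => k; rewrite /h in_cons.
    by have [<-|ik] := eqVneq i k; rewrite ?dfwith_in// dfwith_out.
  have hsi : h s i = y i by rewrite /h (negbTE si).
  have -> : tens y - tens (h (i :: s)) =
      (tens y - tens (h s)) + tens (dfwith (h s) (y i - y' i)) :> tensor (fun i => X i : lmodType R).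
    have := tens_linear (V := fun i => X i : lmodType R) (h s) (-1) (y' i) (y i).
    rewrite scaleN1r [- _ + _]addrC => ->.
    have -> : dfwith (h s) (y i) = h s by rewrite -hsi dfwith_self.
    by rewrite hi scaleN1r [X in _ = _ + X]addrC addrA subrK.
  rewrite (le_trans (NS.1 _ _))// -natr1 mulrDl mul1r lerD ?IH//.
  rewrite (le_trans (projective_norm_tens _))// (bigD1 i)//= dfwith_in.
  apply: ler_pM => //; first by apply: prodr_ge0.
  apply: (@le_trans _ _ (\prod_(k < l | k != i) M)).
    apply: ler_prod => k ki; rewrite dfwith_out; last by rewrite eq_sym.
    by rewrite normr_ge0 /h /=; case: (k \in s).
  rewrite prodr_const; apply: ler_weXn2l => //.
  by rewrite (leq_trans (max_card _))// card_ord.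
have -> : y' = h (enum 'I_l).
  by apply: functional_extensionality_dep => i; rewrite /h mem_enum.
by have := H _ (enum_uniq 'I_l); rewrite size_enum_ord.
Qed.

Section Discretization.
Context {R : realType}.

Lemma step_seq_subproof n (c : nat -> 'I_n) (x : euc R n) :
  (fun m => x 0 (c m) : R^o) \in ell_infty_pred.
Proof.
apply/asboolP; exists (\sum_a `|x 0 a|) => m.
by rewrite (bigD1 (c m))//= lerDl sumr_ge0.
Qed.

Definition step_seq n (c : nat -> 'I_n) (x : euc R n) : ell_infty R :=
  EllInfty (step_seq_subproof c x).

Lemma step_seq_linear n (c : nat -> 'I_n) : linear (step_seq c).
Proof. by move=> a u v; apply: ell_infty_ext => m; rewrite /= !mxE. Qed.

Definition sample n (r : 'I_n -> nat) (y : ell_infty R) : euc R n :=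
  \row_a (y (r a) : R).

Lemma sample_linear n (r : 'I_n -> nat) : linear (sample r).
Proof. by move=> a u v; apply/rowP => b; rewrite !mxE. Qed.

(** The transpose of [sample] for the pairing of l_1 with l_oo. *)
Definition atoms n (r : 'I_n -> nat) (x : euc R n) : ell_one R :=
  \sum_a x 0 a *: unit_seq (r a).

End Discretization.

Section Duality.
Context {R : realType} {l : nat} (l_gt0 : (0 < l)%N).
Context (E : 'I_l -> euclideanType R).
Context (q : forall i, {linear ell_one R -> E i}) (j : forall i, {linear E i -> ell_infty R}).
Arguments q : clear implicits.
Arguments j : clear implicits.
Hypothesis qj : forall i x y, dot (q i x) y = ell_pair x (j i y) :> R.
Local Notation N := (@projective_norm R l (fun=> ell_infty R)).
Local Notation L1 := (tensor (fun _ : 'I_l => ell_one R : lmodType R)).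
Local Notation Loo := (tensor (fun _ : 'I_l => ell_infty R : lmodType R)).

(** For fixed [u] the pairing with [u] is a linear functional on the tensor product of
    the l_oo, bounded on elementary tensors by the definition of the injective norm. *)
Lemma dot_tensor_map_le (u : L1) (z : etensor E) :
  `|dot (tensor_map q u : etensor E) z : R| <=
    @injective_norm R l (fun=> ell_one R) u * N (tensor_map j z).
Proof.
have [n [c [x ux]]] := tensor_span u.
pose Psi (w : Loo) := \sum_(k < n) c k * w (prod_form (fun i => ell_pairr (x k i))).
have PsiS : seminorm (fun w => `|Psi w|).
  split=> [v w|a v].
    rewrite (_ : Psi (v + w) = Psi v + Psi w) ?ler_normD// -big_split/=.
    by apply: eq_bigr => k _; rewrite -mulrDr.
  rewrite (_ : Psi (a *: v) = a * Psi v) ?normrM// mulr_sumr.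
  by apply: eq_bigr => k _; rewrite mulrCA.
have -> : dot (tensor_map q u : etensor E) z = Psi (tensor_map j z) :> R.
  rewrite dotC ux linear_sum dot_sumr; apply: eq_bigr => k _.
  rewrite linearZ /= dotZr tensor_map_tens; congr (_ * _).
  change (z (dot_form (fun i => q i (x k i))) =
    z (mform_comp j (prod_form (fun i => ell_pairr (x k i)))) :> R).
  f_equal; apply: mform_ext => y /=; apply: eq_bigr => i _.
  by rewrite /dotr dotC qj.
apply: (projective_norm_max l_gt0 PsiS) => [|y].
  apply: le_trans (injective_norm_ge u (f := fun=> \0) _) => //.
  by move=> i v; rewrite normr0.
have -> : Psi (tens y) = u (prod_form (fun i => ell_pairl (y i))) :> R.
  by rewrite ux tensor_sumE; apply: eq_bigr => k _.
apply: injective_norm_form => // i v; rewrite mulrC; exact: ell_pair_le.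
Qed.

(** After sampling, a functional on the tensor product of the l_oo factors through a
    finite-dimensional space, where it is a combination of products of point
    evaluations.  Point evaluations are unit sequences of l_1, which gives [u]; its
    injective norm is at most 1 because a functional of norm at most 1 on l_1 is a sequence in
    the unit ball of l_oo, to which sampling and [Phi] apply. *)
Lemma discretization n (r : 'I_n -> nat) (c : nat -> 'I_n) (Phi : {scalar Loo}) :
  (forall w, `|Phi w| <= N w) ->
  exists2 u : L1, @injective_norm R l (fun=> ell_one R) u <= 1 &
    forall z, dot (tensor_map q u : etensor E) z =
      Phi (tensor_map (fun i => mk_linear (@step_seq_linear R _ c) \o
        (mk_linear (@sample_linear R _ r) \o j i)) z) :> R.
Proof.
move=> PhiN.
pose V := mk_linear (@step_seq_linear R _ c); pose rho := mk_linear (@sample_linear R _ r).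
have fP (v : 'I_l -> ell_infty R) i :
    scalar (fun x : ell_infty R => Phi (tens (@dfwith _ (fun=> ell_infty R) v i x) : Loo)).
  move=> a x y.
  by rewrite (tens_linear (V := fun=> ell_infty R : lmodType R)) linearP.
pose Pf := @MForm R l (fun=> ell_infty R : lmodType R) (fun x => Phi (tens x)) fP.
pose F (i : 'I_l) : euclideanType R := euc R n.
pose f := mform_comp (V := fun i => F i : lmodType R) (fun=> V) Pf.
(* The coefficients are the values of the sampled functional on the orthonormal
   tensors, so that the expansion of multilinear forms applies in the next step. *)
pose u : L1 := \sum_(a : onb_index F) f (onb_tuple a) *:
   tens (fun i => atoms r (onb_tuple a i)).
have uE (g : 'I_l -> {scalar ell_one R}) (y : 'I_l -> ell_infty R) :
    (forall i n, g i (unit_seq n) = y i n) ->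
    u (prod_form g) = Phi (tens (fun i => V (rho (y i)))) :> R.
  move=> gy.
  have -> : Phi (tens (fun i => V (rho (y i)))) = f (fun i => rho (y i) : F i) by [].
  rewrite mform_onb_expand.
  have -> : u (prod_form g) = \sum_(a : onb_index F) f (onb_tuple a) *
      (tens (fun i => atoms r (onb_tuple a i)) : L1) (prod_form g) :> R.
    rewrite /u; elim/big_rec2 : _ => // a v w _ <-; exact: tensor_addE.
  apply: eq_bigr => a _; congr (_ * _); apply: eq_bigr => i _.
  have dE : dot (rho (y i) : F i) (onb_tuple a i) =
      \sum_b onb_tuple a i 0 b * (y i (r b) : R) :> R.
    by apply: eq_bigr => b _; rewrite mxE mulrC.
  apply: (etrans _ (esym dE)).
  by rewrite /atoms linear_sum; apply: eq_bigr => b _; rewrite linearZ gy.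
clearbody u; exists u.
  apply: injective_norm_le => g gX.
  have yP i : (fun m => g i (unit_seq m) : R^o) \in ell_infty_pred.
    by apply/asboolP; exists 1 => m; rewrite (le_trans (gX _ _))// unit_seq_norm.
  pose y i := EllInfty (yP i).
  rewrite (uE g y)// (le_trans (PhiN _))// (le_trans (projective_norm_tens _))//.
  apply: prodr_ile1 => i _; rewrite normr_ge0 /=.
  apply: (@ell_infty_norm_le R) => m; rewrite /= mxE /=.
  by rewrite (le_trans (gX _ _))// unit_seq_norm.
move=> z; have [m [d [x ->]]] := tensor_span z.
rewrite dot_sumr !linear_sum; apply: eq_bigr => k _.
rewrite dotZr !linearZ /= tensor_map_tens; congr (_ * _).
change ((tensor_map q u) (dot_form (x k)) = Phi (tens (fun i => V (rho (j i (x k i))))) :> R).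
rewrite -(uE (fun i => dotr (x k i) \o q i : {scalar ell_one R})) => [|i b].
  change (u (mform_comp q (dot_form (x k))) =
    u (prod_form (fun i => dotr (x k i) \o q i : {scalar ell_one R})) :> R).
  by f_equal; apply: mform_ext.
by rewrite /= /dotr qj ell_pair_unit.
Qed.

(** The duality between the injective norm on l_1 and the projective norm on l_oo, for
    tensors of finite-dimensional origin. *)
Theorem projective_norm_dual (z : etensor E) :
  (forall u : L1, dot (tensor_map q u : etensor E) z <=
    @injective_norm R l (fun=> ell_one R) u :> R) ->
  N (tensor_map j z) <= 1.
Proof.
move=> zq.
have NS := projective_norm_seminorm l_gt0 (X := fun=> ell_infty R).
have [Phi Phiz PhiN] := seminorm_support (tensor_map j z) NS.
apply/ler_addgt0Pr => e e0.
have [n [x zx]] := tensor_sum_tens z l_gt0.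
pose M := 1 + \sum_(k < n) \sum_i `|j i (x k i)|.
have M1 : 1 <= M by rewrite lerDl; apply: sumr_ge0 => k _; apply: sumr_ge0.
have xM k i : `|j i (x k i)| <= M.
  rewrite /M (bigD1 k)//= (bigD1 i)//= addrCA -!addrA lerDl.
  by rewrite !addr_ge0// ?sumr_ge0// => k' _; rewrite sumr_ge0.
(* The exchange of all factors in all n terms costs e / C times C - 1. *)
pose C := n%:R * (l%:R * M ^+ l) + 1.
have M0 : 0 <= M by rewrite (le_trans ler01).
have C0 : 0 < C by rewrite ltr_wpDl// !mulr_ge0 ?exprn_ge0.
pose s := flatten [seq [seq j i (x k i) | i <- enum 'I_l] | k <- enum 'I_n].
have [m [r [c rc]]] := ell_infty_finite_net s (divr_gt0 e0 C0).
pose S i : {linear E i -> ell_infty R} :=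
  mk_linear (@step_seq_linear R _ c) \o (mk_linear (@sample_linear R _ r) \o j i).
have [u u1 uz] := discretization r c PhiN.
have Sx k i : `|S i (x k i)| <= M.
  apply: le_trans (xM k i); apply: (@ell_infty_norm_le R) => a; rewrite /= mxE.
  exact: ell_infty_ball.
have jS k i : `|j i (x k i) - S i (x k i)| <= e / C.
  apply: (@ell_infty_norm_le R) => a.
  have -> : (j i (x k i) - S i (x k i)) a = j i (x k i) a - j i (x k i) (r (c a)) :> R.
    by rewrite -[LHS]/(j i (x k i) a - S i (x k i) a) /= mxE.
  apply: rc; apply/flattenP; exists [seq j i (x k i) | i <- enum 'I_l].
    by apply/mapP; exists k; rewrite ?mem_enum.
  by apply/mapP; exists i; rewrite ?mem_enum.
have close : N (tensor_map j z - tensor_map S z) <= e.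
  have zE (T : forall i, {linear E i -> ell_infty R}) :
      tensor_map T z = \sum_(k < n) tens (fun i => T i (x k i)).
    by rewrite zx linear_sum; apply: eq_bigr => k _; exact: tensor_map_tens.
  rewrite !zE -sumrB (le_trans (seminorm_sum NS _))//.
  apply: (@le_trans _ _ (\sum_(k < n) l%:R * (e / C * M ^+ l))).
    apply: ler_sum => k _.
    by apply: (tens_close l_gt0) => //; rewrite divr_ge0 ?ltW.
  rewrite sumr_const card_ord -[leLHS]mulr_natl.
  have -> : n%:R * (l%:R * (e / C * M ^+ l)) = (n%:R * (l%:R * M ^+ l)) * e / C by ring.
  by rewrite ler_pdivrMr// mulrC ler_pM2l// /C lerDl.
rewrite -Phiz -[tensor_map j z](subrK (tensor_map S z)) linearD addrC lerD//.
  by rewrite -uz (le_trans (zq u)).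
by rewrite (le_trans (ler_norm _))// (le_trans (PhiN _)).
Qed.

End Duality.

(** * The projective hull of the injective product *)

Section QuotientSeminorm.
Context {R : realType} {V W : lmodType R} (f : {linear V -> W}) (p : V -> R).
Hypotheses (pS : seminorm p) (fS : forall w, exists v, f v = w).

Definition quotient_seminorm w := inf [set p v | v in [set v | f v = w]].

Lemma quotient_seminorm_le v : quotient_seminorm (f v) <= p v.
Proof.
apply: ge_inf; last by exists v.
by exists 0 => _ [u _ <-]; exact: seminorm_ge0.
Qed.

Lemma quotient_seminorm_lt w r : quotient_seminorm w < r ->
  exists2 v, f v = w & p v < r.
Proof.
move=> /inf_lt[|_ [v vw <-] vr]; last by exists v.
by have [v vw] := fS w; exists (p v), v.
Qed.

Lemma quotient_seminormP : seminorm quotient_seminorm.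
Proof.
have pZ a w : quotient_seminorm (a *: w) <= `|a| * quotient_seminorm w.
  apply/ler_addgt0Pr => e e0.
  have a1 : 0 < `|a| + 1 by rewrite ltr_wpDl.
  have [|v <- pv] := @quotient_seminorm_lt w (quotient_seminorm w + e / (`|a| + 1)).
    by rewrite ltrDl divr_gt0.
  rewrite -linearZ (le_trans (quotient_seminorm_le _))// pS.2.
  rewrite (le_trans (ler_wpM2l _ (ltW pv)))// mulrDr lerD2l mulrA.
  by rewrite ler_pdivrMr// mulrC ler_wpM2l ?(ltW e0)// lerDl.
split=> [x y|a w].
  apply/ler_addgt0Pr => e e0.
  have e2 : 0 < e / 2 by rewrite divr_gt0.
  have [|u ux pu] := @quotient_seminorm_lt x (quotient_seminorm x + e / 2).
    by rewrite ltrDl.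
  have [|v vy pv] := @quotient_seminorm_lt y (quotient_seminorm y + e / 2).
    by rewrite ltrDl.
  have := quotient_seminorm_le (u + v); rewrite linearD /= ux vy.
  have := pS.1 u v; lra.
apply/eqP; rewrite eq_le pZ/=; have [->|a0] := eqVneq a 0.
  rewrite normr0 mul0r scale0r; apply: lb_le_inf.
    by exists (p 0), 0 => //=; rewrite linear0.
  by move=> _ [v _ <-]; exact: seminorm_ge0.
have := pZ a^-1 (a *: w); rewrite scalerA mulVf// scale1r normfV.
by rewrite ler_pdivlMl ?normr_gt0.
Qed.

End QuotientSeminorm.

Lemma tensor_map_surj {R : realType} {l : nat} (l_gt0 : (0 < l)%N)
    {V W : 'I_l -> lmodType R} (T : forall i, {linear V i -> W i}) :
  (forall i w, exists v, T i v = w) -> forall w, exists v, tensor_map T v = w.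
Proof.
move=> TS w; have [n [x ->]] := tensor_sum_tens w l_gt0.
pose y k i := projT1 (cid (TS i (x k i))).
exists (\sum_k tens (y k)); rewrite linear_sum; apply: eq_bigr => k _.
rewrite /= tensor_map_tens; congr tens.
by apply: functional_extensionality_dep => i; exact: (projT2 (cid (TS i (x k i)))).
Qed.

Lemma dense_closed {T : topologicalType} (D C : set T) :
  dense D -> closed C -> D `<=` C -> forall x, C x.
Proof.
move=> Dd Cc DC x; apply: contrapT => nCx.
have [|y [nCy Dy]] := Dd (~` C) _ (closed_openC Cc); first by exists x.
exact: nCy (DC _ Dy).
Qed.

Section ProjectiveHull.
Context {R : realType} {l : nat} (l_gt0 : (0 < l)%N).
Context (E : 'I_l -> euclideanType R) (P : forall i, set (E i)).
Arguments P : clear implicits.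
Hypothesis PB : forall i, sym_convex_body (P i).

(** The dual of the injective product is the bipolar of the projective one, and the
    values of [b] are their own bipolars. *)
Lemma le_dual_eps_prod (b : @body_op R l) : tensor_product b ->
  le_op (dual_op (@eps_prod R l)) b <-> le_op (@pi_prod R l) b.
Proof.
move=> bT.
have dE (F : 'I_l -> euclideanType R) (Q : forall i, set (F i)) :
    (forall i, sym_convex_body (Q i)) ->
    dual_op (@eps_prod R l) Q = polar (polar (pi_prod Q)).
  move=> QB; rewrite /dual_op /eps_prod /dual_op.
  congr (polar (polar (pi_prod _))).
  by apply: functional_extensionality_dep => i; exact: bipolar.
split=> le F Q QB.
  by apply: subset_trans (le F Q QB); rewrite dE//; exact: sub_polar2.
rewrite dE// -(bipolar (tensor_product_body bT QB)).
by apply: polar_anti; apply: polar_anti; exact: le.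
Qed.

Lemma proj_op_eps_prod :
  proj_op (@eps_prod R l) P = polar (inj_op (@pi_prod R l) (fun i => polar (P i))).
Proof.
rewrite /proj_op /dual_op -/(dual_op _); congr polar.
by apply/seteqP; split=> z zb b bT bI le; apply: zb => //; apply/(le_dual_eps_prod bT).
Qed.

Context (q : forall i, {linear ell_one R -> E i}).
Arguments q : clear implicits.
Hypothesis qP : forall i, quotient_mapping (P i) (q i).
Local Notation L1 := (tensor (fun _ : 'I_l => ell_one R : lmodType R)).
Context (X : completeNormedModType R) (iota : {linear L1 -> X}).
Hypothesis iotaP : is_completion (@injective_norm R l (fun=> ell_one R)) iota.
Context (Q : {linear X -> etensor E}).
Hypotheses (Qc : continuous Q) (Qiota : forall u, Q (iota u) = tensor_map q u).

Theorem proj_op_eps_prodE : proj_op (@eps_prod R l) P = closure (Q @` unit_ball X).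
Proof.
have PB' i := polar_body (PB i).
have adj i := cid (quotient_adjoint (PB i) (qP i)).
pose j i := projT1 (adj i).
have jP i : isometric_embedding (polar (P i)) (j i) := (projT2 (adj i)).1.
have qj i x y : dot (q i x) y = ell_pair x (j i y) :> R := (projT2 (adj i)).2 x y.
rewrite proj_op_eps_prod (inj_op_pi_prod l_gt0 PB' jP).
set A : set (etensor E) := [set z | _].
have AB : sym_convex_body A.
  by rewrite /A -(ell_infty_prodE l_gt0 PB' jP); exact: (ell_infty_prod_body l_gt0).
apply/seteqP; split=> [x /polarP xA|].
  have qS : forall w, exists v, tensor_map q v = w.
    by apply: (tensor_map_surj l_gt0) => i w; exact: (quotient_surj (PB i) (qP i)).
  have iotaS : seminorm (fun u => `|iota u|).
    exact: (seminorm_comp normr_seminorm iota).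
  pose p := quotient_seminorm (tensor_map q : {linear L1 -> etensor E}) (fun u => `|iota u|).
  have pS : seminorm p by exact: quotient_seminormP.
  have [f fx fle] := seminorm_support x pS.
  have [z fz] := riesz f.
  have Az : A z.
    apply: (projective_norm_dual l_gt0 qj) => u.
    rewrite -fz -iotaP.1 (le_trans (ler_norm _))// (le_trans (fle _))//.
    exact: (quotient_seminorm_le _ iotaS).
  have px : p x <= 1 by rewrite -fx fz dotC; exact: xA.
  (* Shrinking x makes its seminorm smaller than 1, so that it has a preimage in the
     unit ball. *)
  apply: closed_ray; first exact: closed_closure.
  move=> u u0 u1; apply: subset_closure.
  have [|v vx v1] := quotient_seminorm_lt (p := fun u => `|iota u|) qS (w := u *: x) (r := 1).
    rewrite -/p pS.2 gtr0_norm// (le_lt_trans _ u1)//.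
    by rewrite ger_pMr.
  by exists (iota v); [exact: ltW|rewrite Qiota].
have clA := body_closed (polar_body AB).
rewrite (closure_id (polar A)).1//; apply: closure_subset.
move=> _ [xi xi1 <-]; apply/polarP => z Az.
suff H : `|dot (Q xi) z : R| <= `|xi|.
  by rewrite dotC (le_trans (ler_norm _))// (le_trans H).
have dS : seminorm (fun y : etensor E => `|dot y z : R|).
  by split=> [y y'|a y]; [rewrite dotDl ler_normD|rewrite dotZl normrM].
apply: (dense_closed (C := [set xi | `|dot (Q xi) z : R| <= `|xi|]) iotaP.2).
  rewrite (_ : [set _ | _] =
      (fun xi => `|dot (Q xi) z : R| - `|xi| : R^o) @^-1` [set r | r <= 0]).
    apply: preimage_closed; last exact: closed_le.
    move=> y _; apply: (@continuousB _ _ _ (fun v => `|dot (Q v) z : R| : R^o)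
      (fun v => `|v| : R^o)); last exact: norm_continuous.
    apply: (@continuous_comp _ _ _ Q (fun v => `|dot v z : R| : R^o)).
      exact: Qc.
    exact: (seminorm_continuous dS).
  by apply/seteqP; split=> y /=; rewrite subr_le0.
move=> _ [u _ <-] /=; rewrite Qiota iotaP.1.
rewrite (le_trans (dot_tensor_map_le l_gt0 qj u z))// ler_piMr//.
by rewrite -iotaP.1.
Qed.

End ProjectiveHull.

Unset Implicit Arguments.

Theorem theorem3p11 (R : realType) (l : nat) (l_gt0 : (0 < l)%N)
    (E : 'I_l -> euclideanType R) (P : forall i, set (E i))
    (P_body : forall i, sym_convex_body (P i)) :
  (forall j : forall i, {linear E i -> ell_infty R},
    (forall i, isometric_embedding (P i) (j i)) ->
    forall (X : completeNormedModType R)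
      (iota : {linear tensor (fun _ : 'I_l => ell_infty R : lmodType R) -> X}),
    is_completion (@projective_norm R l (fun=> ell_infty R)) iota ->
    inj_op (@pi_prod R l) P =
    tensor_map j @^-1` (iota @^-1` unit_ball X `&` range (tensor_map j)))
  /\
  (forall q : forall i, {linear ell_one R -> E i},
    (forall i, quotient_mapping (P i) (q i)) ->
    forall (X : completeNormedModType R)
      (iota : {linear tensor (fun _ : 'I_l => ell_one R : lmodType R) -> X}),
    is_completion (@injective_norm R l (fun=> ell_one R)) iota ->
    forall Q : {linear X -> etensor E},
    continuous Q -> (forall u, Q (iota u) = tensor_map q u) ->
    (* The image of the closed ball is not closed in general, while the left-hand
       side is compact. *)
    proj_op (@eps_prod R l) P = closure (Q @` unit_ball X)).
Proof.
split=> [j jP X iota iotaP|q qP X iota iotaP Q Qc Qiota]; last first.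
  exact: (proj_op_eps_prodE l_gt0 P_body qP iotaP Qc Qiota).
rewrite (inj_op_pi_prod l_gt0 P_body jP).
apply/seteqP; split=> [z jz|z [jz _]].
  by split; [rewrite /= /unit_ball /= iotaP.1|exists z].
by move: jz; rewrite /= /unit_ball /= iotaP.1.
Qed.
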